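(* Let $M=\{r=0\}\subset\mathbb{C}^{n+1}$ be a real hypersurface through the origin with $$r(z)=2\,\mathrm{Re}(z_{n+1})+\sum_{j=1}^{N}|f_j(z_1,\dots,z_{n+1})|^2,$$ where $f_1,\dots,f_N$ are holomorphic functions on a neighborhood of the origin vanishing at the origin, and assume that the D'Angelo 1-type of $M$ at the origin is finite. Then the model associated to $M$ at the origin is also a sum of squares domain. In other words, in the multitype coordinates (the coordinates produced by the Kolář algorithm), the model polynomial has the form $$H(z,\bar z)=2\,\mathrm{Re}(z_{n+1})+\sum_{j=1}^{N}|h_j(z_1,\dots,z_n)|^2,$$ where $h_j$ is the polynomial consisting of all terms of the Taylor expansion of $f_j$ (written in these coordinates) of weighted degree $1/2$ with respect to the multitype weight $\Lambda^*$ of $M$ at the origin.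
   Context: The D'Angelo 1-type of $M=\{r=0\}$ at $0$ is $\Delta_1(M,0)=\sup_\varphi \mathrm{ord}_0(r\circ\varphi)/\mathrm{ord}_0(\varphi)$ over nonconstant germs of holomorphic curves $\varphi:(\mathbb{C},0)\to(\mathbb{C}^{n+1},0)$. A sum of squares domain is one with boundary defining function $2\,\mathrm{Re}(z_{n+1})+\sum_j|f_j|^2$, with $f_j$ holomorphic near and vanishing at the origin. Weights and multitype. A weight is an $n$-tuple $\Lambda=(\mu_1,\dots,\mu_n)$ of rationals, $0\le\mu_j\le\frac12$, $\mu_j\ge\mu_{j+1}$, such that for each $t$ either $\mu_t=0$ or there are nonnegative integers $a_1,\dots,a_t$, $a_t>0$, with $\sum_{j\le t}a_j\mu_j=1$. Weights are ordered lexicographically. With $w=u+iv$ of weight $1$, the monomial $z^\alpha\bar z^{\hat\alpha}u^l$ has weighted degree $l+|(\alpha,\hat\alpha)|_\Lambda$, $|(\alpha,\hat\alpha)|_\Lambda=\sum_{j=1}^n(\alpha_j+\hat\alpha_j)\mu_j$; a polynomial is $\Lambda$-homogeneous of weighted degree $\kappa$ if it is a sum of monomials of weighted degree $\kappa$; weighted orders of derivatives are defined in the same way. $\Lambda$ is distinguished for $M$ at $0$ if there are local holomorphic coordinates $(z,w)$ centered at $0$ in which $M$ is $v=P(z,\bar z)+o_\Lambda(1)$, where $P$ is $\Lambda$-homogeneous of weighted degree $1$ without pluriharmonic terms and $o_\Lambda(1)$ is a smooth function whose derivatives of weighted order $\le1$ vanish at $0$; such coordinates are called $\Lambda$-adapted.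 The multitype weight $\Lambda^*=(\mu_1,\dots,\mu_n)$ is the greatest lower bound (lexicographically) of all distinguished weights at $0$; the multitype is $(1/\mu_1,\dots,1/\mu_n)$ (with $1/0=\infty$). $\Lambda^*$-adapted coordinates are called multitype coordinates. For $M=\{2\,\mathrm{Re}(z_{n+1})+F=0\}$ one takes $w=-2iz_{n+1}$, so the equation reads $v=F$; $z_{n+1}$ has weight $1$. Kolář algorithm (all multitype entries finite). Start in coordinates in which $F$ has no pluriharmonic terms (in $z,\bar z$). Let $m_1$ (the Bloom–Graham type) be the lowest degree of a monomial in $z,\bar z$ in $F$, $\mu_1=1/m_1$, $\Lambda_1=(\mu_1,\dots,\mu_1)$, and let $P_1$ be the sum of the terms of weighted degree $1$ with respect to $\Lambda_1$. Given $\Lambda_t=(\lambda^t_1,\dots,\lambda^t_n)$ and $P_t$: among all $\Lambda_t$-homogeneous transformations ($\tilde z_i=z_i+\phi_i$, $\tilde w=w+g$, with $\phi_i$, $g$ holomorphic $\Lambda_t$-homogeneous polynomials of weighted degree $\lambda_i^t$, resp. $1$) choose one making $P_t$ independent of the largest number $d_t$ of variables; for sums of squares these leave $z_{n+1}$ unchanged. In the new coordinates, $P_t=P_t(z_1,\dots,z_{n-d_t},\bar z_1,\dots,\bar z_{n-d_t})$ and $M$ is $v=P_t+Q_t+o(u)$ with $Q_t=\sum_{|(\alpha,\hat\alpha)|_{\Lambda_t}>1}C^t_{\alpha,\hat\alpha}z^\alpha\bar z^{\hat\alpha}$. If $d_t=0$, stop: $\Lambda^*=\Lambda_t$. Otherwise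 let $\Theta_t=\{(\alpha,\hat\alpha): C^t_{\alpha,\hat\alpha}\ne0,\ \sum_{i\le n-d_t}(\alpha_i+\hat\alpha_i)\lambda^t_i<1\}$, $$W_t(\alpha,\hat\alpha)=\frac{1-\sum_{i=1}^{n-d_t}(\alpha_i+\hat\alpha_i)\lambda^t_i}{\sum_{i=n-d_t+1}^{n}(\alpha_i+\hat\alpha_i)},$$ set $\lambda^{t+1}_i=\lambda^t_i$ for $i\le n-d_t$, $\lambda^{t+1}_i=\max_{\Theta_t}W_t$ for $i>n-d_t$, and let $P_{t+1}$ be the sum of the terms of weighted degree $1$ with respect to $\Lambda_{t+1}$. Model. The model polynomial $H$ is the sum of all monomials of the Taylor expansion of the defining function (in multitype coordinates) of weighted degree $1$ with respect to $\Lambda^*$; the model hypersurface is $M_H=\{H=0\}$. *)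

(* Defs.v *)
From mathcomp Require Import all_boot all_order all_algebra.
From mathcomp Require Import all_classical all_reals.
From mathcomp Require Import ereal topology normedtype sequences derive.
From mathcomp Require Import complex.
From mathcomp Require mpoly.

(* Multinomials and MathComp-Analysis declare incompatible notations, so only
   the names of the former are imported. *)
Export -(notations) mpoly.
Export Normc.

Set Implicit Arguments.
Unset Strict Implicit.
Unset Printing Implicit Defensive.

Import Order.TTheory GRing.Theory Num.Theory.
Import numFieldNormedType.Exports.

Local Open Scope classical_set_scope.
Local Open Scope ring_scope.
Local Open Scope complex_scope.

(* Points of C^m are functions 'I_m -> R[i].  In C^(n+1) the distinguished
   variable z_(n+1) has index ord_max. *)

Definition first_vars (T : Type) (n : nat) (z : 'I_n.+1 -> T) : 'I_n -> T :=
  fun i => z (widen_ord (leqnSn n) i).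

Definition append_var (T : Type) (n : nat) (z : 'I_n -> T) (w : T) :
    'I_n.+1 -> T :=
  fun i => if unlift ord_max i is Some j then z j else w.

Definition vnorm (R : realType) (m : nat) (z : 'I_m -> R[i]) : R :=
  \sum_i normc (z i).

(* (z, conj z) in C^(2m): polynomials and power series in z and conj z are
   polynomials and power series in 2m variables, evaluated at [zzbar z]. *)
Definition zzbar (R : realType) (m : nat) (z : 'I_m -> R[i]) :
    'I_(m + m) -> R[i] :=
  fun i => match fintype.split i with inl j => z j | inr j => (z j)^* end.

(* The partial sum, over the multi-indices of total degree < k, of the power
   series with coefficients c. *)
Definition psum (R : realType) (p : nat) (c : multinom p -> R[i]) (k : nat)
    (x : 'I_p -> R[i]) : R[i] :=
  \sum_(a : bmultinom p k) c a * mmap1 x a.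

(* Holomorphic near 0: sum of a power series on a polydisc.  The bound on the
   coefficients makes the convergence absolute, hence independent of the order
   of summation. *)
Definition holomorphic_near0 (R : realType) (m : nat)
    (f : ('I_m -> R[i]) -> R[i]) : Prop :=
  exists (c : multinom m -> R[i]) (rho : R),
    [/\ 0 < rho,
        exists K : R, forall a, normc (c a) * rho ^+ mdeg a <= K
      & forall z, (forall i, normc (z i) < rho) ->
          (fun k => normc (f z - psum c k z)) @ \oo --> (0 : R)].

(* c is the family of Taylor coefficients at 0 of g in the variables [e z],
   characterized by Taylor's formula with remainder O(|z|^k) for every k. *)
Definition is_taylor (R : realType) (m p : nat)
    (e : ('I_m -> R[i]) -> 'I_p -> R[i]) (g : ('I_m -> R[i]) -> R[i])
    (c : multinom p -> R[i]) : Prop :=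
  forall k : nat, exists K delta : R, 0 < delta /\
    forall z, (forall i, normc (z i) < delta) ->
      normc (g z - psum c k (e z)) <= K * vnorm z ^+ k.

Definition holo_taylor (R : realType) (m : nat)
    (g : ('I_m -> R[i]) -> R[i]) (c : multinom m -> R[i]) : Prop :=
  is_taylor id g c.

Definition real_taylor (R : realType) (m : nat)
    (g : ('I_m -> R[i]) -> R) (c : multinom (m + m) -> R[i]) : Prop :=
  is_taylor (@zzbar R m) (fun z => (g z)%:C) c.

Definition sos (R : realType) (n N : nat)
    (f : 'I_N -> ('I_n.+1 -> R[i]) -> R[i]) (z : 'I_n.+1 -> R[i]) : R :=
  2 * complex.Re (z ord_max) + \sum_j normc (f j z) ^+ 2.

(* F = sum_j |f_j|^2 at z_(n+1) = 0: its Taylor coefficients are those of the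
   monomials of F in z and conj z alone. *)
Definition sos_z (R : realType) (n N : nat)
    (f : 'I_N -> ('I_n.+1 -> R[i]) -> R[i]) (z : 'I_n -> R[i]) : R :=
  \sum_j normc (f j (append_var z 0)) ^+ 2.

Definition vanishing_order (R : realType) (g : R[i] -> R) : \bar R :=
  ereal_sup [set x : \bar R | exists k : nat, x = (k%:R : R)%:E /\
    exists K delta : R, 0 < delta /\
      forall t, normc t < delta -> `|g t| <= K * normc t ^+ k].

Definition nonconstant_curve_germ (R : realType) (m : nat)
    (phi : R[i] -> 'I_m -> R[i]) : Prop :=
  [/\ forall i, holomorphic_near0 (fun x : 'I_1 -> R[i] => phi (x ord0) i),
      forall i, phi 0 i = 0
    & forall delta : R, 0 < delta ->
        exists t, normc t < delta /\ exists i, phi t i != 0].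

Definition dangelo_type (R : realType) (m : nat) (r : ('I_m -> R[i]) -> R) :
    \bar R :=
  ereal_sup [set x : \bar R | exists phi : R[i] -> 'I_m -> R[i],
    nonconstant_curve_germ phi /\
    x = (vanishing_order (fun t => r (phi t)) *
         ((fine (vanishing_order (fun t => vnorm (phi t))))^-1)%:E)%E].

Definition wdeg (p : nat) (w : 'I_p -> rat) (a : multinom p) : rat :=
  \sum_i (a i)%:R * w i.

Definition double_weight (m : nat) (w : 'I_m -> rat) : 'I_(m + m) -> rat :=
  fun i => match fintype.split i with inl j => w j | inr j => w j end.

Definition whomogeneous (R : realType) (p : nat) (w : 'I_p -> rat) (k : rat)
    (P : mpoly p R[i]) : Prop :=
  forall a, mcoeff a P != 0 -> wdeg w a = k.

Definition is_wpart (R : realType) (p : nat) (w : 'I_p -> rat) (k : rat)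
    (c : multinom p -> R[i]) (P : mpoly p R[i]) : Prop :=
  forall a, mcoeff a P = if wdeg w a == k then c a else 0.

Definition is_weight (n : nat) (L : 'I_n -> rat) : Prop :=
  [/\ forall i, 0 <= L i <= 2^-1,
      forall i j : 'I_n, (i <= j)%N -> L j <= L i
    & forall t, L t = 0 \/ exists a : 'I_n -> nat,
        (0 < a t)%N /\ \sum_(j < n | (j <= t)%N) (a j)%:R * L j = 1].

Definition lex_le (n : nat) (L L' : 'I_n -> rat) : Prop :=
  (forall i, L i = L' i) \/
  exists i : 'I_n, (forall j : 'I_n, (j < i)%N -> L j = L' j) /\ L i < L' i.

(* Psi sends the new coordinates to the old ones. *)
Definition local_coordinates (R : realType) (m : nat)
    (Psi : ('I_m -> R[i]) -> 'I_m -> R[i]) : Prop :=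
  exists Psi' : ('I_m -> R[i]) -> 'I_m -> R[i],
    [/\ forall i, holomorphic_near0 (fun x => Psi x i),
        forall i, holomorphic_near0 (fun x => Psi' x i),
        forall i, Psi (fun=> 0) i = 0,
        forall i, Psi' (fun=> 0) i = 0
      & exists delta : R, 0 < delta /\
          forall x, (forall i, normc (x i) < delta) ->
            (forall i, Psi' (Psi x) i = x i) /\
            (forall i, Psi (Psi' x) i = x i)].

(* Smooth functions of (z, u) are functions of (Re z, Im z, u). *)
Definition real_coords (R : realType) (n : nat) (z : 'I_n -> R[i]) (u : R) :
    'rV[R]_(n + n + 1) :=
  row_mx (row_mx (\row_i complex.Re (z i)) (\row_i complex.Im (z i))) u%:M.

Definition real_weight (n : nat) (L : 'I_n -> rat) : 'I_(n + n + 1) -> rat :=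
  fun i => match fintype.split i with inl j => double_weight L j | inr _ => 1 end.

Definition iter_partial (R : realType) (m : nat) (s : seq 'I_m)
    (E : 'rV[R]_m -> R) : 'rV[R]_m -> R :=
  foldr (fun i g => fun x => derive g x (delta_mx 0 i)) E s.

Definition smooth_near0 (R : realType) (m : nat) (E : 'rV[R]_m -> R) : Prop :=
  \forall x \near (0 : 'rV[R]_m), forall s : seq 'I_m,
    {for x, continuous (iter_partial s E)} /\
    forall i, derivable (iter_partial s E) x (delta_mx 0 i).

Definition little_o_weight (R : realType) (n : nat) (L : 'I_n -> rat)
    (E : 'rV[R]_(n + n + 1) -> R) : Prop :=
  smooth_near0 E /\
  forall s : seq 'I_(n + n + 1),
    \sum_(i <- s) real_weight L i <= 1 -> iter_partial s E 0 = 0.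

Definition no_pluriharmonic (R : realType) (n : nat) (P : mpoly (n + n) R[i]) :
    Prop :=
  forall a, mcoeff a P != 0 ->
    (exists i : 'I_n, a (lshift n i) != 0%N) /\
    (exists i : 'I_n, a (rshift n i) != 0%N).

Definition distinguished (R : realType) (n : nat)
    (M : set ('I_n.+1 -> R[i])) (L : 'I_n -> rat) : Prop :=
  is_weight L /\
  exists (Psi : ('I_n.+1 -> R[i]) -> 'I_n.+1 -> R[i])
         (P : mpoly (n + n) R[i]) (E : 'rV[R]_(n + n + 1) -> R),
    [/\ local_coordinates Psi,
        whomogeneous (double_weight L) 1 P /\ no_pluriharmonic P,
        forall z, complex.Im (meval (zzbar z) P) = 0,
        little_o_weight L E
      & exists delta : R, 0 < delta /\
          forall x, (forall i, normc (x i) < delta) ->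
            (M (Psi x) <->
             complex.Im (x ord_max) =
               complex.Re (meval (zzbar (first_vars x)) P)
               + E (real_coords (first_vars x) (complex.Re (x ord_max))))].

Definition multitype_weight (R : realType) (n : nat)
    (M : set ('I_n.+1 -> R[i])) (L : 'I_n -> rat) : Prop :=
  [/\ is_weight L,
      forall L', distinguished M L' -> lex_le L L'
    & forall L0, is_weight L0 ->
        (forall L', distinguished M L' -> lex_le L0 L') -> lex_le L0 L].

Definition poly_map (R : realType) (n : nat) (T : n.-tuple (mpoly n R[i]))
    (z : 'I_n -> R[i]) : 'I_n -> R[i] :=
  fun i => meval z (tnth T i).

Definition id_map (R : realType) (n : nat) : n.-tuple (mpoly n R[i]) :=
  [tuple mpolyX _ (mnm1 i) | i < n].

Definition comp_map (R : realType) (n : nat) (T U : n.-tuple (mpoly n R[i])) :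
    n.-tuple (mpoly n R[i]) :=
  [tuple comp_mpoly U (tnth T i) | i < n].

(* The change of coordinates of C^(n+1) acting by T on z_1, ..., z_n and
   leaving z_(n+1) unchanged. *)
Definition extend_map (R : realType) (n : nat) (T : n.-tuple (mpoly n R[i]))
    (z : 'I_n.+1 -> R[i]) : 'I_n.+1 -> R[i] :=
  append_var (poly_map T (first_vars z)) (z ord_max).

(* The L-homogeneous transformation z~ = S z = z + phi z, with inverse U:
   a function g of z becomes g o U in the new coordinates z~. *)
Definition homogeneous_transformation (R : realType) (n : nat)
    (L : 'I_n -> rat) (S U : n.-tuple (mpoly n R[i])) : Prop :=
  [/\ forall i, exists phi : mpoly n R[i],
        whomogeneous L (L i) phi /\ tnth S i = mpolyX _ (mnm1 i) + phi,
      comp_map S U = id_map R n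
    & comp_map U S = id_map R n].

Definition independent_of (R : realType) (n : nat)
    (g : ('I_n -> R[i]) -> R[i]) (i : 'I_n) : Prop :=
  forall z z', (forall k, k != i -> z k = z' k) -> g z = g z'.

(* P in the new coordinates z~ = U^-1 z, as a function of z~. *)
Definition transformed (R : realType) (n : nat) (P : mpoly (n + n) R[i])
    (U : n.-tuple (mpoly n R[i])) (z : 'I_n -> R[i]) : R[i] :=
  meval (zzbar (poly_map U z)) P.

(* The inverse transformation U makes P independent of the last d variables,
   and d is the largest number of variables of which P can be made
   independent. *)
Definition best_transformation (R : realType) (n : nat) (L : 'I_n -> rat)
    (P : mpoly (n + n) R[i]) (U : n.-tuple (mpoly n R[i])) (d : nat) : Prop :=
  [/\ (d <= n)%N,
      exists S, homogeneous_transformation L S U,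
      forall i : 'I_n, (n - d <= i)%N -> independent_of (transformed P U) i
    & forall S' U' (A : {set 'I_n}), homogeneous_transformation L S' U' ->
        (forall i, i \in A -> independent_of (transformed P U') i) ->
        (#|A| <= d)%N].

Definition lowest_degree (R : realType) (p : nat) (c : multinom p -> R[i])
    (k : nat) : Prop :=
  (exists a, c a != 0 /\ mdeg a = k) /\ forall a, c a != 0 -> (k <= mdeg a)%N.

Definition var_degree (n : nat) (a : multinom (n + n)) (i : 'I_n) : nat :=
  (a (lshift n i) + a (rshift n i))%N.

Definition head_weight (n : nat) (L : 'I_n -> rat) (d : nat)
    (a : multinom (n + n)) : rat :=
  \sum_(i < n | (i < n - d)%N) (var_degree a i)%:R * L i.

Definition Theta (R : realType) (n : nat) (c : multinom (n + n) -> R[i])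
    (L : 'I_n -> rat) (d : nat) : set (multinom (n + n)) :=
  [set a | [/\ c a != 0, 1 < wdeg (double_weight L) a & head_weight L d a < 1]].

Definition Wratio (n : nat) (L : 'I_n -> rat) (d : nat)
    (a : multinom (n + n)) : rat :=
  (1 - head_weight L d a) /
  (\sum_(i < n | (n - d <= i)%N) var_degree a i)%N%:R.

Definition next_weight (n : nat) (L : 'I_n -> rat) (d : nat) (tau : rat) :
    'I_n -> rat :=
  fun i => if (i < n - d)%N then L i else tau.

(* [kolar_stage f T L d]: a run of the algorithm reaches a stage t with weight
   L = Lambda_t and d = d_t; the coordinates z~ chosen at that stage (those in
   which P_t is independent of the last d variables) are related to the
   original ones by z = T z~. *)
Inductive kolar_stage (R : realType) (n N : nat)
    (f : 'I_N -> ('I_n.+1 -> R[i]) -> R[i]) :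
    n.-tuple (mpoly n R[i]) -> ('I_n -> rat) -> nat -> Prop :=
| KolarStart c (m1 : nat) P U d :
    real_taylor (sos_z f) c ->
    lowest_degree c m1 ->
    let L1 : 'I_n -> rat := fun=> (m1%:R)^-1 in
    is_wpart (double_weight L1) 1 c P ->
    best_transformation L1 P U d ->
    kolar_stage f U L1 d
| KolarStep T L d c (a : multinom (n + n)) P U d' :
    kolar_stage f T L d ->
    (0 < d)%N ->
    real_taylor (sos_z f \o poly_map T) c ->
    Theta c L d a ->
    (forall b, Theta c L d b -> Wratio L d b <= Wratio L d a) ->
    let L' := next_weight L d (Wratio L d a) in
    is_wpart (double_weight L') 1 c P ->
    best_transformation L' P U d' ->
    kolar_stage f (comp_map T U) L' d'.

Definition kolar_output (R : realType) (n N : nat)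
    (f : 'I_N -> ('I_n.+1 -> R[i]) -> R[i]) (T : n.-tuple (mpoly n R[i]))
    (L : 'I_n -> rat) : Prop :=
  kolar_stage f T L 0.

Definition full_weight (n : nat) (L : 'I_n -> rat) : 'I_n.+1 -> rat :=
  append_var L 1.

Definition is_model (R : realType) (n : nat) (r : ('I_n.+1 -> R[i]) -> R)
    (L : 'I_n -> rat) (H : mpoly (n.+1 + n.+1) R[i]) : Prop :=
  exists c, real_taylor r c /\
    is_wpart (double_weight (full_weight L)) 1 c H.

(* h (in z_1, ..., z_n only) is the sum of the terms of weighted degree k of
   the Taylor expansion of g. *)
Definition is_holo_part (R : realType) (n : nat)
    (g : ('I_n.+1 -> R[i]) -> R[i]) (L : 'I_n -> rat) (k : rat)
    (h : mpoly n R[i]) : Prop :=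
  exists c, holo_taylor g c /\ is_wpart (full_weight L) k c (mwiden h).

(* Main.v *)
(* A sum F = sum_j |f_j|^2 can be handled through the Taylor coefficients u_j of
   the f_j: the coefficient of z^a conj(z)^a in F is sum_j |u_(j,a)|^2.  Hence if
   all terms of F have weight >= 1, all terms of every f_j have weight >= 1/2, the
   part of F of weight 1 is the sum of the squared moduli of the parts of weight
   1/2 of the f_j, and it is independent of a variable iff each of these is.
   All stages of the algorithm preserve the bound >= 1, which gives the form of the
   model at the last stage.

   The algorithm terminates: as long as d_t > 0, a curve along a coordinate axis of
   the current coordinates shows that some pure power z_n^k of bounded degree occurs
   in some f_j, so that the tail weights stay bounded below.  The number d_t does not
   increase, and while it is constant the tail weight decreases strictly through a
   discrete set. *)
Require Import Defs.
From mathcomp Require Import all_boot all_order all_algebra fingroup perm.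
From mathcomp Require Import all_classical all_reals.
From mathcomp Require Import ereal topology normedtype sequences derive.
From mathcomp Require Import complex.
From mathcomp Require Import ring lra zify.
Import Order.TTheory GRing.Theory Num.Theory.
Import numFieldNormedType.Exports.
Local Open Scope classical_set_scope.
Local Open Scope ring_scope.
Local Open Scope complex_scope.

Set Implicit Arguments.
Unset Strict Implicit.
Unset Printing Implicit Defensive.

(** Maximality of d_t refers to Lambda_t-homogeneous maps, and a Lambda_(t+1)-homogeneous map need
    not be one, so comparing consecutive stages is the delicate point. The tail variables have
    strictly smallest weight in Lambda_(t+1); hence such a map preserves the subspace where they
    vanish, and its restriction there, extended by the identity on the tail, is
    Lambda_t-homogeneous. It follows that any set of variables eliminated at stage t+1 lies in the
    old tail. This fact serves twice: it gives d_(t+1) <= d_t, and, since the old tail variables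
    share one weight, a permutation can move a largest eliminated set to the last positions, as the
    algorithm demands, without leaving the homogeneous maps. Theta_t can be infinite, so even the
    maximum of W_t needs an argument. Finite type yields a bound B depending on f alone, not on the
    current coordinates; it provides a ratio of at least 1/(2B), and all competing ratios then have
    bounded denominators. The expansions in a run are arbitrary families satisfying Taylor's
    formula; uniqueness of such families ties them to the u_j. *)

Local Notation "p \mPo T" := (comp_mpoly T p) (at level 50).

(** * Remainders of order k at the origin *)

Section BigO.
Variable R : realType.
Local Notation C := R[i].

Lemma normc_ge0 (x : C) : 0 <= normc x.
Proof. by case: x => a b /=; rewrite sqrtr_ge0. Qed.

Lemma normc_conj (x : C) : normc x^* = normc x.
Proof. by case: x => a b /=; rewrite sqrrN. Qed.

Lemma normcX (x : C) k : normc (x ^+ k) = normc x ^+ k.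
Proof. by elim: k => [|k IH]; rewrite ?expr0 ?normc1 // !exprS normcM IH. Qed.

Lemma normc_real (x : R) : normc x%:C = `|x|.
Proof. by rewrite /= expr0n addr0 sqrtr_sqr. Qed.

Lemma sqr_normc_mul (x : C) : (normc x ^+ 2)%:C = x * x^*.
Proof. by rewrite -sqr_normc -rmorphXn. Qed.

Lemma normc_sum_le (I : Type) (r : seq I) (P : pred I) (F : I -> C) :
  normc (\sum_(i <- r | P i) F i) <= \sum_(i <- r | P i) normc (F i).
Proof.
elim/big_rec2: _ => [|i y x _ h]; first by rewrite normc0.
by apply: (le_trans (le_normcD _ _)); rewrite lerD2l.
Qed.

Lemma normc_prod (I : Type) (r : seq I) (P : pred I) (F : I -> C) :
  normc (\prod_(i <- r | P i) F i) = \prod_(i <- r | P i) normc (F i).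
Proof. by elim/big_rec2: _ => [|i y x _ h]; rewrite ?normc1 // normcM h. Qed.

Lemma vnorm_ge0 m (z : 'I_m -> C) : 0 <= vnorm z.
Proof. by apply: sumr_ge0 => i _; apply: normc_ge0. Qed.

Lemma normc_le_vnorm m (z : 'I_m -> C) i : normc (z i) <= vnorm z.
Proof.
rewrite /vnorm (bigD1 i) //= lerDl; apply: sumr_ge0 => j _; exact: normc_ge0.
Qed.

(** Same shape as the remainder in [is_taylor], so that a Taylor expansion is by conversion a family
    of [bigO] statements, one for each order. *)
Definition bigO m (k : nat) (g : ('I_m -> C) -> C) : Prop :=
  exists K delta : R, 0 < delta /\
    forall z, (forall i, normc (z i) < delta) ->
      normc (g z) <= K * vnorm z ^+ k.

Lemma bigO_pos m k (g : ('I_m -> C) -> C) : bigO k g ->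
  exists K delta : R, [/\ 0 <= K, 0 < delta, delta <= 1 &
    forall z, (forall i, normc (z i) < delta) ->
      normc (g z) <= K * vnorm z ^+ k].
Proof.
move=> [K [d [d0 h]]]; exists `|K|, (Num.min d 1).
split=> //; rewrite ?lt_min ?d0 ?ltr01 ?ge_min ?lexx ?orbT //.
move=> z hz; apply: le_trans (h z _) _.
  by move=> i; have := hz i; rewrite lt_min => /andP[].
by rewrite ler_wpM2r ?exprn_ge0 ?vnorm_ge0 ?ler_norm.
Qed.

Lemma bigO_ext m k (g g' : ('I_m -> C) -> C) : g =1 g' -> bigO k g -> bigO k g'.
Proof.
by move=> e [K [d [d0 h]]]; exists K, d; split=> // z hz; rewrite -e; exact: h.
Qed.

Lemma bigO_conj m k (g : ('I_m -> C) -> C) :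
  bigO k g -> bigO k (fun z => (g z)^*).
Proof.
by move=> [K [d [d0 h]]]; exists K, d; split=> // z /h; rewrite normc_conj.
Qed.

Lemma bigO_add m k (f g : ('I_m -> C) -> C) :
  bigO k f -> bigO k g -> bigO k (fun z => f z + g z).
Proof.
move=> [K [d [d0 h]]] [K' [d' [d0' h']]]; exists (K + K'), (Num.min d d').
split; first by rewrite lt_min d0.
move=> z hz; have [hz1 hz2] : (forall i, normc (z i) < d) /\
    (forall i, normc (z i) < d').
  by split=> i; have := hz i; rewrite lt_min => /andP[].
by rewrite mulrDl (le_trans (le_normcD _ _)) // lerD // ?h ?h'.
Qed.

Lemma bigO_opp m k (f : ('I_m -> C) -> C) :
  bigO k f -> bigO k (fun z => - f z).
Proof.
by move=> [K [d [d0 h]]]; exists K, d; split=> // z /h; rewrite normcN.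
Qed.

Lemma bigO_sub m k (f g : ('I_m -> C) -> C) :
  bigO k f -> bigO k g -> bigO k (fun z => f z - g z).
Proof. by move=> hf hg; apply: bigO_add => //; apply: bigO_opp. Qed.

Lemma bigO_mul m k l (f g : ('I_m -> C) -> C) :
  bigO k f -> bigO l g -> bigO (k + l) (fun z => f z * g z).
Proof.
move=> [K [d [d0 h]]] [K' [d' [d0' h']]]; exists (K * K'), (Num.min d d').
split; first by rewrite lt_min d0.
move=> z hz; have [hz1 hz2] : (forall i, normc (z i) < d) /\
    (forall i, normc (z i) < d').
  by split=> i; have := hz i; rewrite lt_min => /andP[].
by rewrite normcM exprD mulrACA ler_pM ?normc_ge0 ?h ?h'.
Qed.

(** Dividing by m + 1 rather than m keeps the bound strict and meaningful also for m = 0. *)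
Lemma vnorm_lt m (z : 'I_m -> C) (d : R) : 0 < d ->
  (forall i, normc (z i) < d / m.+1%:R) -> vnorm z < d.
Proof.
move=> d0 h; have : vnorm z <= \sum_(i < m) d / m.+1%:R.
  by apply: ler_sum => i _; apply: ltW.
rewrite sumr_const card_ord => /le_lt_trans; apply.
by rewrite -[_ *+ _]mulr_natr -mulrA gtr_pMr // mulrC ltr_pdivrMr ?mul1r ?ltr_nat ?ltr0n.
Qed.

(** On a smaller polydisc the sum norm is below 1, so its powers decrease with the exponent. *)
Lemma bigO_le m k l (f : ('I_m -> C) -> C) : (l <= k)%N ->
  bigO k f -> bigO l f.
Proof.
move=> lk /bigO_pos[K [d [K0 d0 d1 h]]].
exists K, (d / m.+1%:R); split; first by rewrite divr_gt0 ?ltr0n.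
move=> z hz.
have hv : vnorm z < d by apply: vnorm_lt.
apply: le_trans (h z _) _.
  by move=> i; apply: le_lt_trans hv; apply: normc_le_vnorm.
rewrite ler_wpM2l // -(subnKC lk) exprD ler_piMr ?exprn_ge0 ?vnorm_ge0 //.
by rewrite exprn_ile1 ?vnorm_ge0 // ltW // (lt_le_trans hv).
Qed.

Lemma bigO_cst m (c : C) : bigO 0 (fun _ : 'I_m -> C => c).
Proof. by exists (normc c), 1; split=> // z _; rewrite expr0 mulr1. Qed.

Lemma bigO_zero m k : bigO k (fun _ : 'I_m -> C => 0).
Proof. by exists 0, 1; split=> // z _; rewrite normc0 mul0r. Qed.

Lemma bigO_proj m (i : 'I_m) : bigO 1 (fun z : 'I_m -> C => z i).
Proof.
by exists 1, 1; split=> // z _; rewrite mul1r expr1 normc_le_vnorm.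
Qed.

Lemma bigO_sum m k (I : Type) (r : seq I) (P : pred I)
    (F : I -> ('I_m -> C) -> C) :
  (forall i, P i -> bigO k (F i)) ->
  bigO k (fun z => \sum_(i <- r | P i) F i z).
Proof.
move=> h; elim: r => [|a r IH].
  by apply: bigO_ext (bigO_zero _ _) => z; rewrite big_nil.
case Pa: (P a); last by apply: bigO_ext IH => z; rewrite big_cons Pa.
by apply: bigO_ext (bigO_add (h a Pa) IH) => z; rewrite big_cons Pa.
Qed.

Lemma bigO_expr m k l (f : ('I_m -> C) -> C) :
  bigO k f -> bigO (k * l) (fun z => f z ^+ l).
Proof.
move=> h; elim: l => [|l IH]; first by rewrite muln0; apply: bigO_cst.
by rewrite mulnS; apply: bigO_ext (bigO_mul h IH) => z; rewrite exprS.
Qed.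

Lemma bigO_prod m (I : Type) (r : seq I) (k : I -> nat)
    (F : I -> ('I_m -> C) -> C) :
  (forall i, bigO (k i) (F i)) ->
  bigO (\sum_(i <- r) k i)%N (fun z => \prod_(i <- r) F i z).
Proof.
move=> h; elim: r => [|a r IH].
  by rewrite big_nil; apply: bigO_ext (bigO_cst _ 1) => z; rewrite big_nil.
by rewrite big_cons; apply: bigO_ext (bigO_mul (h a) IH) => z; rewrite big_cons.
Qed.

Lemma bigO_mmap1 m p (e : ('I_m -> C) -> 'I_p -> C) (a : multinom p) :
  (forall i, bigO 1 (fun z => e z i)) -> bigO (mdeg a) (fun z => mmap1 (e z) a).
Proof.
move=> h; rewrite mdegE; apply: bigO_prod => i.
by have := bigO_expr (a i) (h i); rewrite mul1n.
Qed.

Lemma meval_sum p k (x : 'I_p -> C) (q : mpoly p C) : (msize q <= k)%N ->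
  meval x q = psum (fun a => mcoeff a q) k x.
Proof. by move=> h; rewrite /meval (mmapE (f := idfun) (h := x) k h). Qed.

Lemma bigO_meval m p k (e : ('I_m -> C) -> 'I_p -> C) (q : mpoly p C) :
  (forall i, bigO 1 (fun z => e z i)) ->
  (forall a, mcoeff a q != 0 -> (k <= mdeg a)%N) ->
  bigO k (fun z => meval (e z) q).
Proof.
move=> he h.
apply: (@bigO_ext _ _ (fun z => psum (fun a => mcoeff a q) (msize q) (e z))).
  by move=> z; rewrite -meval_sum.
apply: bigO_sum => a _.
have [->|/h ka] := eqVneq (mcoeff a q) 0.
  by apply: bigO_ext (bigO_zero _ _) => z; rewrite mul0r.
apply: bigO_ext (bigO_mul (bigO_cst _ (mcoeff a q)) (bigO_le ka (bigO_mmap1 a he))) => //.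
Qed.

Lemma bigO_vnorm m p (T : ('I_m -> C) -> 'I_p -> C) :
  (forall i, bigO 1 (fun z => T z i)) ->
  exists K delta : R, [/\ 0 <= K, 0 < delta & forall z,
    (forall i, normc (z i) < delta) -> vnorm (T z) <= K * vnorm z].
Proof.
move=> h.
have : bigO 1 (fun z => \sum_i (normc (T z i))%:C).
  apply: bigO_sum => i _; have [K [d [d0 hd]]] := h i; exists K, d; split=> // z hz.
  by rewrite normc_real ger0_norm ?normc_ge0 // hd.
move=> /bigO_pos[K [d [K0 d0 d1 hd]]]; exists K, d; split=> // z /hd.
rewrite -rmorph_sum normc_real expr1 ger0_norm //.
exact: vnorm_ge0.
Qed.

Lemma bigO_comp m p k (T : ('I_m -> C) -> 'I_p -> C) (g : ('I_p -> C) -> C) :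
  (forall i, bigO 1 (fun z => T z i)) -> bigO k g -> bigO k (fun z => g (T z)).
Proof.
move=> hT /bigO_pos[K [d [K0 d0 d1 hd]]].
have [K' [d' [K0' d0' hd']]] := bigO_vnorm hT.
(* K' may be 0, hence the 1; [vnorm z < e] makes [vnorm (T z) < d], so that T z lies in the polydisc
   where g is estimated. *)
pose e := d / (K' + 1); have e0 : 0 < e by rewrite divr_gt0 // ltr_wpDl.
exists (K * K' ^+ k), (Num.min d' (e / m.+1%:R)).
split; first by rewrite lt_min d0' divr_gt0 ?ltr0n.
move=> z hz; have [hz1 hz2] : (forall i, normc (z i) < d') /\
    (forall i, normc (z i) < e / m.+1%:R).
  by split=> i; have := hz i; rewrite lt_min => /andP[].
have hv := vnorm_lt e0 hz2.
have hT1 := hd' z hz1.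
apply: le_trans (hd (T z) _) _ => [i|].
  apply: le_lt_trans (normc_le_vnorm _ _) _; apply: le_lt_trans hT1 _.
  have : (K' + 1) * vnorm z < d.
    by rewrite mulrC -ltr_pdivlMr // ltr_wpDl.
  by apply: le_lt_trans; rewrite mulrDl mul1r lerDl vnorm_ge0.
by rewrite -mulrA -exprMn ler_wpM2l // lerXn2r // nnegrE ?vnorm_ge0 ?mulr_ge0 ?vnorm_ge0.
Qed.

End BigO.

(** * Taylor coefficients *)

Section Truncation.
Variable R : realType.
Local Notation C := R[i].

Definition trunc p (c : multinom p -> C) (k : nat) : mpoly p C :=
  \sum_(a : bmultinom p k) c a *: mpolyX C a.

Lemma mcoeff_trunc p (c : multinom p -> C) k a :
  mcoeff a (trunc c k) = if (mdeg a < k)%N then c a else 0.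
Proof.
case: ifP => h; first by rewrite /trunc mcoeff_mpoly.
rewrite /trunc raddf_sum big1 // => b _; rewrite /= mcoeffZ mcoeffX.
case: eqP => [e|]; last by rewrite mulr0.
by have := bmdeg b; rewrite e h.
Qed.

Lemma msize_leP p k (q : mpoly p C) :
  (forall a, mcoeff a q != 0 -> (mdeg a < k)%N) -> (msize q <= k)%N.
Proof.
move=> h; rewrite msizeE; apply/bigmax_leqP_seq => a ha _.
by apply: h; rewrite -mcoeff_msupp.
Qed.

Lemma msize_trunc p (c : multinom p -> C) k : (msize (trunc c k) <= k)%N.
Proof. by apply: msize_leP => a; rewrite mcoeff_trunc; case: ifP; rewrite ?eqxx. Qed.

Lemma psum_widen p (c : multinom p -> C) k l (x : 'I_p -> C) : (k <= l)%N ->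
  psum c k x = psum (fun a => if (mdeg a < k)%N then c a else 0) l x.
Proof.
move=> kl; have -> : psum c k x = meval x (trunc c k).
  rewrite (meval_sum x (msize_trunc c k)); apply: eq_bigr => a _.
  by rewrite mcoeff_trunc bmdeg.
rewrite (meval_sum x (leq_trans (msize_trunc c k) kl)); apply: eq_bigr => a _.
by rewrite mcoeff_trunc.
Qed.

Lemma meval_trunc p (c : multinom p -> C) k (x : 'I_p -> C) :
  meval x (trunc c k) = psum c k x.
Proof.
rewrite (meval_sum x (msize_trunc c k)); apply: eq_bigr => a _.
by rewrite mcoeff_trunc bmdeg.
Qed.

Lemma mcoeff_gt_msize p (q : mpoly p C) a : (msize q <= mdeg a)%N -> mcoeff a q = 0.
Proof. by move=> /msize_mdeg_ge; rewrite -mcoeff_eq0 => /eqP. Qed.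

End Truncation.

(** * Taylor expansions: characterization, uniqueness, existence *)

Section Taylor.
Variable R : realType.
Local Notation C := R[i].

(** The polynomial Q is only prescribed below degree k, since further terms are themselves O(|z|^k).
    This freedom suits composites and products, whose natural approximating polynomials have
    incorrect terms of high degree. *)
Lemma is_taylorP m p (e : ('I_m -> C) -> 'I_p -> C) g c :
  (forall i, bigO 1 (fun z => e z i)) ->
  is_taylor e g c <->
  forall k, exists Q : mpoly p C, bigO k (fun z => g z - meval (e z) Q) /\
    forall a, (mdeg a < k)%N -> mcoeff a Q = c a.
Proof.
move=> he; split=> h k.
  exists (trunc c k); split; last by move=> a ak; rewrite mcoeff_trunc ak.
  by apply: bigO_ext (h k) => z; rewrite meval_trunc.
have [Q [hQ hc]] := h k.
have : bigO k (fun z => meval (e z) (Q - trunc c k)).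
  apply: bigO_meval he _ => a; rewrite mcoeffB mcoeff_trunc.
  by case: ltnP => // ak; rewrite hc // subrr eqxx.
move=> /(bigO_add hQ) [K [d [d0 hd]]]; exists K, d; split=> // z /hd.
by rewrite mevalB meval_trunc addrA subrK.
Qed.

(** Uniqueness of digits in base D. *)
Lemma kron_inj n D (a b : 'I_n -> nat) :
  (forall i, (a i < D)%N) -> (forall i, (b i < D)%N) ->
  (\sum_(i < n) a i * D ^ i = \sum_(i < n) b i * D ^ i)%N -> a =1 b.
Proof.
elim: n a b => [|n IH] a b ha hb; first by move=> _ [].
rewrite !big_ord_recl !expn0 !muln1 => e.
have D0 : (0 < D)%N by apply: leq_trans (ha ord0).
have step (f : 'I_n.+1 -> nat) : (\sum_(i < n) f (lift ord0 i) * D ^ lift ord0 i =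
    (\sum_(i < n) f (lift ord0 i) * D ^ i) * D)%N.
  by rewrite big_distrl; apply: eq_bigr => i _; rewrite lift0 expnSr mulnA.
move: e; rewrite !step => e.
have e0 : a ord0 = b ord0.
  have := congr1 (modn^~ D) e.
  by rewrite /= ![(_ + _ * D)%N]addnC !modnMDl !modn_small.
have e1 : (fun i => a (lift ord0 i)) =1 (fun i => b (lift ord0 i)).
  apply: IH => //; move: e; rewrite e0 => /addnI /eqP.
  by rewrite eqn_pmul2r // => /eqP.
by move=> i; case: (unliftP ord0 i) => [j ->|->]; [exact: e1 | exact: e0].
Qed.

(* Kronecker substitution [x_i = t ^ (D ^ i)] separates monomials. *)
Lemma mpoly_real_points0 n (p : mpoly n C) :
  (forall x : 'I_n -> R, meval (fun i => (x i)%:C) p = 0) -> p = 0.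
Proof.
move=> h; set D := msize p.
pose e (a : multinom n) : nat := (\sum_(i < n) a i * D ^ i)%N.
pose q : {poly C} := \sum_(a : bmultinom n D) mcoeff a p *: 'X^(e a).
have hq (t : R) : q.[t%:C] = 0.
  rewrite -(h (fun i => t ^+ (D ^ i)%N)) (meval_sum _ (leqnn _)) /q horner_sum.
  apply: eq_bigr => a _; rewrite hornerZ hornerXn; congr (_ * _).
  rewrite /mmap1 /e -prodrXr; apply: eq_bigr => i _.
  by rewrite rmorphXn /= -exprM mulnC.
have q0 : q = 0.
  apply/eqP; apply: contraT => qn0.
  have := @max_poly_roots _ q [seq ((k%:R : R)%:C) | k <- iota 0 (size q)] qn0.
  rewrite size_map size_iota ltnn => -> //.
    by apply/allP => x /mapP[k _ ->]; rewrite /root hq.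
  rewrite map_inj_uniq ?iota_uniq // => k l /complexI /eqP.
  by rewrite eqr_nat => /eqP.
have lta (a : bmultinom n D) i : (a i < D)%N.
  by apply: leq_ltn_trans (bmdeg a); rewrite mdegE (bigD1 i) //= leq_addr.
apply/mpolyP => a; rewrite mcoeff0.
have [aD|/mcoeff_gt_msize //] := ltnP (mdeg a) D.
have := congr1 (fun s : {poly C} => s`_(e a)) q0.
rewrite coef0 coef_sum (bigD1 (BMultinom aD)) //= coefZ coefXn eqxx mulr1.
rewrite big1 ?addr0 // => b ba; rewrite coefZ coefXn.
case: eqP => [ee|]; last by rewrite mulr0.
case/eqP: ba; apply/val_inj/mnmP => i /=.
by apply: (kron_inj (lta b) (lta (BMultinom aD))); rewrite -[LHS]/(e b) -ee.
Qed.

Lemma mpoly_points0 n (p : mpoly n C) : (forall x, meval x p = 0) -> p = 0.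
Proof. by move=> h; apply: mpoly_real_points0. Qed.

Lemma mpoly_ext n (p q : mpoly n C) : (forall x, meval x p = meval x q) -> p = q.
Proof.
move=> h; apply/eqP; rewrite -subr_eq0; apply/eqP/mpoly_points0 => x.
by rewrite mevalB h subrr.
Qed.

Lemma zzbar_lshift m (z : 'I_m -> C) i : zzbar z (lshift m i) = z i.
Proof. by rewrite /zzbar (unsplitK (inl _ i)). Qed.

Lemma zzbar_rshift m (z : 'I_m -> C) i : zzbar z (rshift m i) = (z i)^*.
Proof. by rewrite /zzbar (unsplitK (inr _ i)). Qed.

(* [p (x + i y, x - i y)] vanishes for real x, y, hence for complex x, y, hence
   p vanishes identically. *)
Lemma mpoly_zzbar0 m (p : mpoly (m + m) C) :
  (forall z, meval (zzbar z) p = 0) -> p = 0.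
Proof.
move=> h.
pose T : (m + m).-tuple (mpoly (m + m) C) := [tuple
  match fintype.split i with
  | inl j => mpolyX C (mnm1 (lshift m j)) + 'i *: mpolyX C (mnm1 (rshift m j))
  | inr j => mpolyX C (mnm1 (lshift m j)) - 'i *: mpolyX C (mnm1 (rshift m j))
  end | i < m + m].
have T0 : p \mPo T = 0.
  apply: mpoly_real_points0 => x; rewrite comp_mpoly_meval.
  rewrite -(h (fun j => (x (lshift m j))%:C + 'i * (x (rshift m j))%:C)).
  apply: meval_eq => i; rewrite tnth_mktuple /zzbar.
  case: (fintype.split i) => j; rewrite ?mevalB ?mevalD mevalZ !mevalXU //.
  rewrite rmorphD rmorphM /= !oppr0; congr (_ + _).
  by simpc.
apply: mpoly_points0 => w.
pose x : 'I_(m + m) -> C := fun i => match fintype.split i with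
  | inl j => (w (lshift m j) + w (rshift m j)) / 2
  | inr j => (w (lshift m j) - w (rshift m j)) / (2 * 'i) end.
have := congr1 (meval x) T0; rewrite meval0 comp_mpoly_meval => <-.
apply: meval_eq => i; rewrite tnth_mktuple.
have i0 : ('i : C) != 0 by rewrite eq_complex /= oner_eq0 andbF.
have {1}-> : i = unsplit (fintype.split i) by rewrite splitK.
case: (fintype.split i) => j /=; rewrite ?mevalB ?mevalD mevalZ !mevalXU /x
  (unsplitK (inl _ j)) (unsplitK (inr _ j)); field; exact: i0.
Qed.

(** At the lowest degree k where the coefficients differ, the difference is a form of degree k that
    is O(|z|^(k+1)). On the ray t z it scales like t^k, so its value at z is O(t), hence 0. Only
    real t are used because conjugation commutes with real scaling alone; the second hypothesis on
    [e] says that its values separate polynomials. *)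
Lemma is_taylor_unique m p (e : ('I_m -> C) -> 'I_p -> C) g c c' :
  (forall (t : R) z i, e (fun j => t%:C * z j) i = t%:C * e z i) ->
  (forall q : mpoly p C, (forall z, meval (e z) q = 0) -> q = 0) ->
  is_taylor e g c -> is_taylor e g c' -> c =1 c'.
Proof.
move=> he hd h h'.
suff H k : forall a, (mdeg a < k)%N -> c a = c' a by move=> a; apply: (H (mdeg a).+1).
elim: k => // k IH a; rewrite ltnS leq_eqVlt => /orP[/eqP ak|]; last exact: IH.
pose q : mpoly p C := trunc c k.+1 - trunc c' k.+1.
have qE b : mcoeff b q = if (mdeg b == k)%N then c b - c' b else 0.
  rewrite mcoeffB !mcoeff_trunc ltnS leq_eqVlt; case: eqP => //= _.
  by case: ifP => [/IH ->|_]; rewrite subrr.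
suff q0 : q = 0.
  by apply/eqP; rewrite -subr_eq0; have := qE a; rewrite q0 mcoeff0 ak eqxx => <-.
apply: hd => z.
have hom (t : R) : meval (e (fun j => t%:C * z j)) q = t%:C ^+ k * meval (e z) q.
  rewrite !(meval_sum _ (leqnn (msize q))) [RHS]big_distrr; apply: eq_bigr => b _ /=.
  rewrite qE; case: eqP => [bk|]; last by rewrite !mul0r mulr0.
  rewrite mulrCA; congr (_ * _); rewrite /mmap1 -{}bk mdegE -prodrXr -big_split.
  by apply: eq_bigr => i _; rewrite he exprMn.
have : bigO k.+1 (fun z => meval (e z) q).
  apply: bigO_ext (bigO_sub (h' k.+1) (h k.+1)) => y.
  by rewrite mevalB !meval_trunc opprB addrC addrA subrK.
move=> /bigO_pos[K [d [K0 d0 d1 hK]]].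
set X := normc (meval (e z) q).
have hX (t : R) : 0 < t -> t * vnorm z < d -> X <= t * (K * vnorm z ^+ k.+1).
  move=> t0 td; have := hK (fun j => t%:C * z j); rewrite hom.
  have -> : vnorm (fun j => t%:C * z j) = t * vnorm z.
    rewrite /vnorm mulr_sumr; apply: eq_bigr => i _.
    by rewrite normcM normc_real gtr0_norm.
  rewrite normcM normcX normc_real gtr0_norm // exprMn exprS.
  have := ler_pM2l (exprn_gt0 k t0) X (t * (K * vnorm z ^+ k.+1)) => <- H.
  apply: le_trans (H _) _ => [i|]; last by rewrite le_eqVlt; apply/orP; left; apply/eqP; ring.
  rewrite normcM normc_real gtr0_norm //; apply: le_lt_trans td.
  by rewrite ler_wpM2l ?normc_le_vnorm // ltW.
apply: eq0_normc; apply/eqP; rewrite eq_le normc_ge0 andbT.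
apply/ler_addgt0Pr => eps eps0; rewrite add0r.
set B := K * vnorm z ^+ k.+1 in hX.
have B0 : 0 <= B by rewrite mulr_ge0 ?exprn_ge0 ?vnorm_ge0.
(* The first entry makes the bound at most eps, the second keeps t z inside the polydisc of radius
   d. *)
pose t := Num.min (eps / (B + 1)) (d / (vnorm z + 1)).
have B1 : 0 < B + 1 by rewrite ltr_wpDl.
have z1 : 0 < vnorm z + 1 by rewrite ltr_wpDl ?vnorm_ge0.
have t0 : 0 < t by rewrite lt_min !divr_gt0.
apply: le_trans (hX t t0 _) _.
  have : t * (vnorm z + 1) <= d by rewrite -ler_pdivlMr // ge_min lexx orbT.
  by apply: lt_le_trans; rewrite mulrDr mulr1 ltrDl.
have : t * (B + 1) <= eps by rewrite -ler_pdivlMr // ge_min lexx.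
by apply: le_trans; rewrite mulrDr mulr1 lerDl ltW.
Qed.

Lemma bigO_zzbar m (i : 'I_(m + m)) : bigO 1 (fun z : 'I_m -> C => zzbar z i).
Proof.
rewrite /zzbar; case: (fintype.split i) => j; first exact: bigO_proj.
by apply: bigO_conj; apply: bigO_proj.
Qed.

Lemma real_taylor_unique m (g : ('I_m -> C) -> R) c c' :
  real_taylor g c -> real_taylor g c' -> c =1 c'.
Proof.
apply: is_taylor_unique => [t z i|q]; last exact: mpoly_zzbar0.
rewrite /zzbar; case: (fintype.split i) => j //.
by rewrite rmorphM /= oppr0.
Qed.

Lemma holo_taylor_unique m (g : ('I_m -> C) -> C) c c' :
  holo_taylor g c -> holo_taylor g c' -> c =1 c'.
Proof. by apply: is_taylor_unique => // q; apply: mpoly_points0. Qed.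

(** The multi-indices embed in a box of side l, and the sum over the box is a product of p geometric
    sums, each at most 2. *)
Lemma sum_half_le p l : \sum_(a : bmultinom p l) (2^-1 : R) ^+ mdeg a <= 2 ^+ p.
Proof.
have lta (a : bmultinom p l) i : (a i < l)%N.
  by apply: leq_ltn_trans (bmdeg a); rewrite mdegE (bigD1 i) //= leq_addr.
pose h (a : bmultinom p l) : {ffun 'I_p -> 'I_l} := [ffun i => Ordinal (lta a i)].
have hinj : injective h.
  move=> a b /ffunP e; apply/val_inj/mnmP => i.
  by have := congr1 val (e i); rewrite !ffunE.
pose G (s : {ffun 'I_p -> 'I_l}) : R := \prod_i (2^-1) ^+ s i.
have -> : \sum_(a : bmultinom p l) (2^-1 : R) ^+ mdeg a = \sum_(a : bmultinom p l) G (h a).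
  apply: eq_bigr => a _; rewrite mdegE -prodrXr; apply: eq_bigr => i _.
  by rewrite ffunE.
have G0 s : 0 <= G s by apply: prodr_ge0 => i _; rewrite exprn_ge0 ?invr_ge0.
have : \sum_(a : bmultinom p l) G (h a) <= \sum_s G s.
  have <- : \sum_(s in h @: [set: bmultinom p l]%SET) G s = \sum_a G (h a).
    rewrite big_imset /=; first by apply: eq_bigl => a; rewrite inE.
    exact: in2W.
  by rewrite [leRHS](bigID (mem (h @: [set: bmultinom p l]%SET))) /= lerDl sumr_ge0.
move=> /le_trans; apply; rewrite /G -(bigA_distr_bigA (fun _ (j : 'I_l) => (2^-1 : R) ^+ j)).
rewrite prodr_const card_ord; apply: lerXn2r; rewrite ?nnegrE //.
  by apply: sumr_ge0 => i _; rewrite exprn_ge0 ?invr_ge0.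
have : \sum_(i < l) (2^-1 : R) ^+ i = 2 - 2 * 2^-1 ^+ l.
  elim: l {lta h hinj G G0} => [|l IH]; first by rewrite big_ord0 expr0 mulr1 subrr.
  by rewrite big_ord_recr /= IH exprS; lra.
by move=> ->; rewrite gerBl mulr_ge0 ?exprn_ge0 ?invr_ge0.
Qed.

Lemma holomorphic_taylor m (f : ('I_m -> C) -> C) :
  holomorphic_near0 f -> exists c, holo_taylor f c.
Proof.
move=> [c [rho [rho0 [K hK] hf]]]; exists c => k.
have K0 : 0 <= K by have := hK (@mnm0 m); rewrite mdeg0 expr0 mulr1; apply: le_trans; apply: normc_ge0.
(* Halving the radius gains a factor 2^-|a| on the term of index a, which makes the majorant
   summable by [sum_half_le]. *)
pose d := rho / 2; have d0 : 0 < d by rewrite divr_gt0.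
exists (K * 2 ^+ m / d ^+ k), (d / m.+1%:R); split; first by rewrite divr_gt0 ?ltr0n.
move=> z hz; have hv : vnorm z < d by apply: vnorm_lt.
have hzr i : normc (z i) < rho.
  apply: le_lt_trans (normc_le_vnorm z i) (lt_trans hv _).
  by rewrite ltr_pdivrMr // mulrDr mulr1 ltrDl.
set B := _ * _.
have hB l : (k <= l)%N -> normc (psum c l z - psum c k z) <= B.
  move=> kl; rewrite (psum_widen _ _ kl) /psum -sumrB.
  apply: le_trans (normc_sum_le _ _ _) _.
  (* B is split into a termwise majorant and a remainder that [sum_half_le] shows to be
     nonnegative. *)
  have -> : B = \sum_(a : bmultinom m l) (K * (vnorm z / d) ^+ k * (2^-1) ^+ mdeg a) +
     (K * (vnorm z / d) ^+ k * (2 ^+ m - \sum_(a : bmultinom m l) (2^-1) ^+ mdeg a)).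
    rewrite -mulr_sumr -mulrDr addrC subrK /B [(vnorm z / d) ^+ k]expr_div_n.
    by move: (vnorm z ^+ k) (d ^+ k)^-1 ((2 : R) ^+ m) => x y w; ring.
  have q0 : 0 <= vnorm z / d by rewrite divr_ge0 ?vnorm_ge0 ?ltW.
  apply: ler_wpDr.
    by rewrite mulr_ge0 ?subr_ge0 ?sum_half_le // mulr_ge0 // exprn_ge0.
  apply: ler_sum => a _; case: ltnP => ka.
    by rewrite subrr normc0 !mulr_ge0 ?exprn_ge0 ?invr_ge0.
  rewrite mul0r subr0 normcM normc_prod.
  have hm : \prod_i normc (z i ^+ a i) <= vnorm z ^+ mdeg a.
    rewrite mdegE -prodrXr; apply: ler_prod => i _.
    by rewrite normc_ge0 normcX lerXn2r ?nnegrE ?normc_ge0 ?vnorm_ge0 ?normc_le_vnorm.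
  have hc : normc (c a) <= K / rho ^+ mdeg a by rewrite ler_pdivlMr ?exprn_gt0.
  apply: le_trans (ler_pM (normc_ge0 _) _ hc hm) _.
    by apply: prodr_ge0 => i _; apply: normc_ge0.
  have -> : K / rho ^+ mdeg a * vnorm z ^+ mdeg a =
      K * (vnorm z / d) ^+ mdeg a * (2^-1) ^+ mdeg a.
    rewrite -!mulrA -[in RHS]exprMn; congr (_ * _).
    rewrite -exprVn -exprMn; congr (_ ^+ _); rewrite /d; field.
    by rewrite lt0r_neq0.
  rewrite ler_wpM2r ?exprn_ge0 ?invr_ge0 // ler_wpM2l //.
  by rewrite -(subnKC ka) exprD ler_piMr ?exprn_ge0 // exprn_ile1 // ler_pdivrMr // mul1r ltW.
(* The bound on partial sums is uniform in l, so it passes to the limit f z: some partial sum beyond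
   order k is within eps of it. *)
apply/ler_addgt0Pr => eps eps0.
have /cvgrPdist_lt /(_ eps eps0) [l _ hl] := hf z hzr.
have := hl (maxn k l) (leq_maxr k l).
rewrite /= sub0r normrN ger0_norm ?normc_ge0 // => h1.
rewrite -(subrK (psum c (maxn k l) z) (f z)) -addrA addrC.
apply: le_trans (le_normcD _ _) _; apply: lerD; last exact: ltW.
exact: hB (leq_maxl k l).
Qed.

Lemma holomorphic_meval m (p : mpoly m C) :
  holomorphic_near0 (fun z => meval z p).
Proof.
exists (fun a => mcoeff a p), 1; split=> //.
  exists (\sum_(a : bmultinom m (msize p)) normc (mcoeff a p)) => a.
  rewrite expr1n mulr1; have [aD|/mcoeff_gt_msize ->] := ltnP (mdeg a) (msize p).
    rewrite (bigD1 (BMultinom aD)) //= lerDl; apply: sumr_ge0 => *; exact: normc_ge0.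
  by rewrite normc0; apply: sumr_ge0 => *; exact: normc_ge0.
move=> z _; apply: cvg_near_cst; exists (msize p) => // k /= hk.
by apply/eqP; rewrite (meval_sum z hk) subrr normc0.
Qed.

End Taylor.

(** * Weights, composition and sums of squares *)

Section Weights.
Variable R : realType.
Local Notation C := R[i].

Lemma wdeg0 n (w : 'I_n -> rat) : wdeg w (@mnm0 n) = 0.
Proof. by rewrite /wdeg big1 // => i _; rewrite mnm0E mul0r. Qed.

Lemma wdegD n (w : 'I_n -> rat) a b :
  wdeg w (mnm_add a b) = wdeg w a + wdeg w b.
Proof.
by rewrite /wdeg -big_split; apply: eq_bigr => i _; rewrite mnmDE natrD mulrDl.
Qed.

Lemma wdeg1 n (w : 'I_n -> rat) i : wdeg w (mnm1 i) = w i.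
Proof.
rewrite /wdeg (bigD1 i) //= mnm1E eqxx mul1r big1 ?addr0 // => j ji.
by rewrite mnm1E eq_sym (negbTE ji) mul0r.
Qed.

Lemma wdeg_cst n (x : rat) (a : multinom n) : wdeg (fun=> x) a = (mdeg a)%:R * x.
Proof. by rewrite /wdeg -mulr_suml mdegE natr_sum. Qed.

Lemma mcoeffM_neq0 n (p q : mpoly n C) b : mcoeff b (p * q) != 0 ->
  exists b1 b2, [/\ b = mnm_add b1 b2, mcoeff b1 p != 0 & mcoeff b2 q != 0].
Proof.
rewrite -mcoeff_msupp => /msuppM_le/allpairsP [[b1 b2] [/= h1 h2 ->]].
by exists b1, b2; rewrite -!mcoeff_msupp.
Qed.

Section CompRel.
Variables (m p : nat) (w : 'I_p -> rat) (w' : 'I_m -> rat).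
Variable (rel : rat -> rat -> Prop).
Hypothesis rel0 : rel 0 0.
Hypothesis relD : forall x y x' y', rel x y -> rel x' y' -> rel (x + x') (y + y').

Let spans (x : rat) (q : mpoly m C) :=
  forall b, mcoeff b q != 0 -> rel x (wdeg w' b).

Let spans1 : spans 0 1.
Proof.
move=> b; rewrite mcoeff1; have [->|_] := eqVneq b (@mnm0 m).
  by rewrite wdeg0.
by rewrite eqxx.
Qed.

Let spansM x y q q' : spans x q -> spans y q' -> spans (x + y) (q * q').
Proof.
move=> hq hq' b /mcoeffM_neq0[b1 [b2 [-> h1 h2]]]; rewrite wdegD.
by apply: relD; [apply: hq | apply: hq'].
Qed.

Let spansX x q k : spans x q -> spans (k%:R * x) (q ^+ k).
Proof.
move=> hq; elim: k => [|k IH]; first by rewrite mul0r expr0.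
by rewrite -natr1 mulrDl mul1r exprSr; apply: spansM.
Qed.

(** Additivity lets [rel] pass from the monomials of the components of T to products of them. Three
    instances are used: equality of weights for homogeneous maps, [<=] of degrees for maps fixing
    the origin, and the vanishing of the target weight for the absence of a variable. *)
Lemma mcoeff_comp_rel (T : p.-tuple (mpoly m C)) :
  (forall i b, mcoeff b (tnth T i) != 0 -> rel (w i) (wdeg w' b)) ->
  forall P b, mcoeff b (P \mPo T) != 0 ->
  exists a, mcoeff a P != 0 /\ rel (wdeg w a) (wdeg w' b).
Proof.
move=> hT P b; rewrite comp_mpolyE raddf_sum => hb.
have [a aP ha] : exists2 a, a \in msupp P &
    mcoeff b (mcoeff a P *: \prod_(i < p) tnth T i ^+ a i) != 0.
  have [/hasP//|/hasPn h] := boolP (has (fun a =>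
    mcoeff b (mcoeff a P *: \prod_(i < p) tnth T i ^+ a i) != 0) (msupp P)).
  move: hb; rewrite big_seq big1 ?eqxx // => a /h.
  by rewrite negbK => /eqP.
exists a; rewrite -mcoeff_msupp; split=> //.
move: ha; rewrite mcoeffZ mulf_eq0 negb_or => /andP[_].
move: b hb; rewrite /wdeg => b _.
suff : spans (\sum_(i < p) (a i)%:R * w i) (\prod_(i < p) tnth T i ^+ a i) by apply.
elim/big_rec2: _ => [|i q x _ h]; first exact: spans1.
by apply: spansM => //; apply: spansX => c; apply: hT.
Qed.

End CompRel.

Lemma whomogeneous_comp m p (w : 'I_p -> rat) (w' : 'I_m -> rat)
    (T : p.-tuple (mpoly m C)) k P :
  (forall i, whomogeneous w' (w i) (tnth T i)) ->
  whomogeneous w k P -> whomogeneous w' k (P \mPo T).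
Proof.
move=> hT hP b hb.
have [||i c|a [ha e]] := @mcoeff_comp_rel _ _ w w' eq _ _ T _ P b hb => //.
- by move=> ? ? ? ? -> ->.
- by move=> /hT ->.
- by rewrite -e; apply: hP.
Qed.

Lemma whomogeneousD n (w : 'I_n -> rat) k (p q : mpoly n C) :
  whomogeneous w k p -> whomogeneous w k q -> whomogeneous w k (p + q).
Proof.
move=> hp hq a; rewrite mcoeffD.
by have [->|/hp //] := eqVneq (mcoeff a p) 0; rewrite add0r => /hq.
Qed.

Lemma whomogeneousX n (w : 'I_n -> rat) i :
  whomogeneous w (w i) (mpolyX C (mnm1 i)).
Proof.
move=> a; rewrite mcoeffX; have [<-|] := eqVneq (mnm1 i) a; last by rewrite eqxx.
by rewrite wdeg1.
Qed.

Lemma whomogeneous0 n (w : 'I_n -> rat) k : whomogeneous w k (0 : mpoly n C).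
Proof. by move=> a; rewrite mcoeff0 eqxx. Qed.

End Weights.

(** * Polynomial substitution in Taylor series *)

Section TaylorComp.
Variable R : realType.
Local Notation C := R[i].

(** T fixes the origin. Substituting T then never lowers the degree of a monomial, so each
    coefficient of a composite depends on finitely many coefficients. *)
Definition cst_free p m (T : p.-tuple (mpoly m C)) :=
  forall i, mcoeff (@mnm0 m) (tnth T i) = 0.

Lemma cst_free_neq0 p m (T : p.-tuple (mpoly m C)) : cst_free T ->
  forall i b, mcoeff b (tnth T i) != 0 -> (1 <= mdeg b)%N.
Proof.
move=> hT i b; rewrite lt0n; apply: contraNneq => /eqP.
by rewrite mdeg_eq0 => /eqP ->; apply/eqP.
Qed.

Lemma mdeg_comp p m (T : p.-tuple (mpoly m C)) P b : cst_free T ->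
  mcoeff b (P \mPo T) != 0 -> exists a, mcoeff a P != 0 /\ (mdeg a <= mdeg b)%N.
Proof.
move=> hT hb.
have [||i c|a [ha e]] := @mcoeff_comp_rel _ _ _ (fun=> 1) (fun=> 1)
  (fun x y => x <= y) _ _ T _ P b hb => //.
- by move=> *; apply: lerD.
- by move=> /(cst_free_neq0 hT); rewrite wdeg_cst mulr1 ler1n.
- by exists a; split=> //; move: e; rewrite !wdeg_cst !mulr1 ler_nat.
Qed.

(** Formal composition of a power series with T; for T fixing the origin, terms of degree above |b|
    cannot contribute to the coefficient of index b. *)
Definition comp_coef p m (T : p.-tuple (mpoly m C)) (c : multinom p -> C)
    (b : multinom m) : C :=
  mcoeff b (trunc c (mdeg b).+1 \mPo T).

Lemma comp_coefE p m (T : p.-tuple (mpoly m C)) c b Q : cst_free T ->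
  (forall a, (mdeg a <= mdeg b)%N -> mcoeff a Q = c a) ->
  comp_coef T c b = mcoeff b (Q \mPo T).
Proof.
move=> hT hQ; apply/eqP; rewrite -subr_eq0 -mcoeffB -raddfB; apply: contraT.
move=> /(mdeg_comp hT)[a [ha ab]]; move: ha.
by rewrite mcoeffB mcoeff_trunc ltnS ab hQ // subrr eqxx.
Qed.

Lemma bigO_poly p m (T : p.-tuple (mpoly m C)) i : cst_free T ->
  bigO 1 (fun z => meval z (tnth T i)).
Proof.
move=> hT; apply: (bigO_meval (e := id)); first exact: bigO_proj.
exact: cst_free_neq0.
Qed.

Lemma holo_taylor_comp p m (T : p.-tuple (mpoly m C)) g c : cst_free T ->
  holo_taylor g c ->
  holo_taylor (fun z => g (fun i => meval z (tnth T i))) (comp_coef T c).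
Proof.
move=> hT hg; apply/is_taylorP => [i|k]; first exact: bigO_proj.
exists (trunc c k \mPo T); split.
  have := bigO_comp (fun i => bigO_poly i hT) (hg k).
  by apply: bigO_ext => z; rewrite comp_mpoly_meval meval_trunc.
move=> b bk; apply/esym/comp_coefE => // a ab.
by rewrite mcoeff_trunc (leq_ltn_trans ab bk).
Qed.

Lemma holo_taylor_ext m (g g' : ('I_m -> C) -> C) c :
  g =1 g' -> holo_taylor g c -> holo_taylor g' c.
Proof.
move=> e h k; have [K [d [d0 hd]]] := h k.
by exists K, d; split=> // z /hd; rewrite e.
Qed.

Lemma holo_taylor0 m (g : ('I_m -> C) -> C) c :
  holo_taylor g c -> c (@mnm0 m) = g (fun=> 0).
Proof.
move=> /(_ 1%N)[K [d [d0 /(_ (fun=> 0))]]].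
rewrite normc0 /vnorm big1 => [|i _]; last by rewrite normc0.
rewrite expr1 mulr0 => /(_ (fun=> d0)) h.
have /eq0_normc /eqP : normc (g (fun=> 0) - psum c 1 (fun=> 0)) = 0.
  by apply/eqP; rewrite eq_le h normc_ge0.
rewrite subr_eq0 => /eqP ->; rewrite -meval_trunc.
have -> : trunc c 1 = mpolyC m (c (@mnm0 m)).
  apply/mpolyP => a; rewrite mcoeff_trunc mcoeffC ltnS leqn0 mdeg_eq0.
  by case: eqP => [->|]; rewrite ?mulr1 ?mulr0.
by rewrite mevalC.
Qed.

End TaylorComp.

(** * Sums of squares as polynomials and series in z and conj z *)

Section SumOfSquares.
Variable R : realType.
Local Notation C := R[i].

Definition mleft m (a : multinom (m + m)) : multinom m :=
  Multinom (mktuple (fun i => a (lshift m i))).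
Definition mright m (a : multinom (m + m)) : multinom m :=
  Multinom (mktuple (fun i => a (rshift m i))).
Definition mjoin m (a b : multinom m) : multinom (m + m) :=
  Multinom (mktuple (fun i =>
    match fintype.split i with inl j => a j | inr j => b j end)).

Lemma mleftE m (a : multinom (m + m)) i : mleft a i = a (lshift m i).
Proof. exact: mnmE. Qed.
Lemma mrightE m (a : multinom (m + m)) i : mright a i = a (rshift m i).
Proof. exact: mnmE. Qed.
Lemma mjoin_lshift m (a b : multinom m) i : mjoin a b (lshift m i) = a i.
Proof. by rewrite mnmE (unsplitK (inl _ i)). Qed.
Lemma mjoin_rshift m (a b : multinom m) i : mjoin a b (rshift m i) = b i.
Proof. by rewrite mnmE (unsplitK (inr _ i)). Qed.

Lemma mjoinKl m (a b : multinom m) : mleft (mjoin a b) = a.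
Proof. by apply/mnmP => i; rewrite mleftE mjoin_lshift. Qed.
Lemma mjoinKr m (a b : multinom m) : mright (mjoin a b) = b.
Proof. by apply/mnmP => i; rewrite mrightE mjoin_rshift. Qed.
Lemma mjoin_eta m (a : multinom (m + m)) : mjoin (mleft a) (mright a) = a.
Proof.
apply/mnmP => i; have := splitK i; case: (fintype.split i) => j <- /=.
  by rewrite mjoin_lshift mleftE.
by rewrite mjoin_rshift mrightE.
Qed.

Lemma mdeg_join m (a b : multinom m) : mdeg (mjoin a b) = (mdeg a + mdeg b)%N.
Proof.
rewrite !mdegE big_split_ord; congr (_ + _)%N; apply: eq_bigr => i _.
  by rewrite mjoin_lshift.
by rewrite mjoin_rshift.
Qed.

Lemma wdeg_join m (w : 'I_m -> rat) (a b : multinom m) :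
  wdeg (double_weight w) (mjoin a b) = wdeg w a + wdeg w b.
Proof.
rewrite /wdeg big_split_ord; congr (_ + _); apply: eq_bigr => i _.
  by rewrite mjoin_lshift /double_weight (unsplitK (inl _ i)).
by rewrite mjoin_rshift /double_weight (unsplitK (inr _ i)).
Qed.

Lemma mmap1_zzbar m (z : 'I_m -> C) a b :
  mmap1 (zzbar z) (mjoin a b) = mmap1 z a * (mmap1 z b)^*.
Proof.
rewrite /mmap1 big_split_ord rmorph_prod; congr (_ * _); apply: eq_bigr => i _.
  by rewrite mjoin_lshift zzbar_lshift.
by rewrite mjoin_rshift zzbar_rshift rmorphXn.
Qed.

Definition herm m (p q : mpoly m C) : mpoly (m + m) C :=
  \sum_(a <- msupp p) \sum_(b <- msupp q)
    (mcoeff a p * (mcoeff b q)^*) *: mpolyX C (mjoin a b).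

Lemma meval_herm m (p q : mpoly m C) z :
  meval (zzbar z) (herm p q) = meval z p * (meval z q)^*.
Proof.
have mE r : meval z r = \sum_(a <- msupp r) mcoeff a r * mmap1 z a by [].
rewrite !mE [X in _ * X]rmorph_sum big_distrlr raddf_sum; apply: eq_bigr => a _ /=.
rewrite raddf_sum; apply: eq_bigr => b _ /=.
by rewrite mevalZ mevalX -[\prod_i _]/(mmap1 _ _) mmap1_zzbar rmorphM mulrACA.
Qed.

Lemma mcoeff_herm m (p q : mpoly m C) c :
  mcoeff c (herm p q) = mcoeff (mleft c) p * (mcoeff (mright c) q)^*.
Proof.
rewrite {2}[p]mpolyE {2}[q]mpolyE !raddf_sum big_distrlr; apply: eq_bigr => a _ /=.
rewrite raddf_sum; apply: eq_bigr => b _ /=.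
rewrite !mcoeffZ !mcoeffX rmorphM rmorph_nat mulrACA -natrM mulnb.
congr (_ * _%:R); congr nat_of_bool; apply/eqP/andP => [<-|[/eqP -> /eqP ->]].
  by rewrite mjoinKl mjoinKr !eqxx.
exact: mjoin_eta.
Qed.

Definition sosc m N (u : 'I_N -> multinom m -> C) (a : multinom (m + m)) : C :=
  \sum_j u j (mleft a) * (u j (mright a))^*.

Definition sosp m N (h : 'I_N -> mpoly m C) : mpoly (m + m) C :=
  \sum_j herm (h j) (h j).

Lemma mcoeff_sosp m N (h : 'I_N -> mpoly m C) a :
  mcoeff a (sosp h) = sosc (fun j b => mcoeff b (h j)) a.
Proof. by rewrite raddf_sum; apply: eq_bigr => j _; rewrite /= mcoeff_herm. Qed.

Lemma meval_sosp m N (h : 'I_N -> mpoly m C) z :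
  meval (zzbar z) (sosp h) = (\sum_j normc (meval z (h j)) ^+ 2)%:C.
Proof.
rewrite raddf_sum rmorph_sum; apply: eq_bigr => j _ /=.
by rewrite meval_herm sqr_normc_mul.
Qed.

Lemma sosc_diag_eq0 m N (u : 'I_N -> multinom m -> C) a :
  sosc u (mjoin a a) = 0 <-> forall j, u j a = 0.
Proof.
rewrite /sosc mjoinKl mjoinKr; split=> [|h]; last first.
  by rewrite big1 // => j _; rewrite h mul0r.
rewrite (eq_bigr (fun j => (normc (u j a) ^+ 2)%:C)); last first.
  by move=> j _; rewrite sqr_normc_mul.
rewrite -rmorph_sum => /complexI/eqP.
rewrite psumr_eq0 => [/allP h j|j _]; last by rewrite exprn_ge0 ?normc_ge0.
have := h j (mem_index_enum _); rewrite expf_eq0 /= => /eqP.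
exact: eq0_normc.
Qed.

(** With p the truncation of g, |g|^2 - |p|^2 = (g - p) conj(g) + p conj(g - p), and each product
    contains a factor of order k. The square |p|^2 has the right coefficients below degree k, which
    is all that [is_taylorP] asks. *)
Lemma real_taylor_sos m N (g : 'I_N -> ('I_m -> C) -> C) u :
  (forall j, holo_taylor (g j) (u j)) ->
  real_taylor (fun z => \sum_j normc (g j z) ^+ 2) (sosc u).
Proof.
move=> hg; apply/is_taylorP => [i|k]; first exact: bigO_zzbar.
exists (sosp (fun j => trunc (u j) k)); split; last first.
  move=> a ak; rewrite mcoeff_sosp; apply: eq_bigr => j _.
  have ak' : (mdeg (mleft a) + mdeg (mright a) < k)%N by rewrite -mdeg_join mjoin_eta.
  by rewrite /= !mcoeff_trunc (leq_ltn_trans (leq_addr _ _) ak')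
    (leq_ltn_trans (leq_addl _ _) ak').
have : bigO k (fun z => \sum_j ((g j z - psum (u j) k z) * (g j z)^* +
    psum (u j) k z * (g j z - psum (u j) k z)^*)).
  apply: bigO_sum => j _.
  have h0 : bigO 0 (psum (u j) k).
    apply: bigO_ext (bigO_meval (e := id) (q := trunc (u j) k) (@bigO_proj _ _) _) => //.
    by move=> z; rewrite meval_trunc.
  apply: bigO_add.
    apply: (@bigO_le _ _ (k + 0)); first by rewrite addn0.
    apply: bigO_mul; first exact: hg.
    apply: bigO_conj; have := bigO_add (bigO_le (leq0n _) (hg j k)) h0.
    by apply: bigO_ext => z; rewrite subrK.
  by apply: (@bigO_mul _ _ 0) => //; apply: bigO_conj; apply: hg.
have E (x y : C) :
    (x - y) * x^* + y * (x - y)^* = (normc x ^+ 2 - normc y ^+ 2)%:C.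
  rewrite rmorphB mulrBl mulrBr addrA subrK [RHS]rmorphB.
  by congr (_ - _); exact/esym/sqr_normc_mul.
apply: bigO_ext => z; rewrite meval_sosp -rmorphB -sumrB rmorph_sum.
by apply: eq_bigr => j _; rewrite E meval_trunc.
Qed.

End SumOfSquares.

(** * Finite type *)

Section CurveOrder.
Variable R : realType.
Local Notation C := R[i].

Lemma append_var_widen (T : Type) n (z : 'I_n -> T) w i :
  append_var z w (widen_ord (leqnSn n) i) = z i.
Proof.
rewrite /append_var (_ : widen_ord _ i = lift ord_max i) ?liftK //.
by apply: val_inj; rewrite /= /bump leqNgt ltn_ord.
Qed.

Lemma append_var_max (T : Type) n (z : 'I_n -> T) w :
  append_var z w ord_max = w.
Proof. by rewrite /append_var unlift_none. Qed.

Lemma vnorm_append0 n (z : 'I_n -> C) : vnorm (append_var z 0) = vnorm z.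
Proof.
rewrite /vnorm big_ord_recr /= append_var_max normc0 addr0.
by apply: eq_bigr => i _; rewrite append_var_widen.
Qed.

Definition axis n (l : 'I_n) (t : C) : 'I_n -> C := fun i => if i == l then t else 0.

Lemma vnorm_axis n (l : 'I_n) t : vnorm (axis l t) = normc t.
Proof.
rewrite /vnorm (bigD1 l) //= /axis eqxx big1 ?addr0 // => i /negbTE ->.
by rewrite normc0.
Qed.

Lemma normc_axis n (l : 'I_n) t i : normc (axis l t i) <= normc t.
Proof. by have := normc_le_vnorm (axis l t) i; rewrite vnorm_axis. Qed.

Lemma psum_axis n (l : 'I_n) (u : multinom n -> C) k t :
  (forall i, (i < k)%N -> u (mnm_muln (mnm1 l) i) = 0) ->
  psum u k (axis l t) = 0.
Proof.
move=> h; rewrite /psum big1 // => a _.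
have [/existsP[i /andP[il ai]]|] := boolP [exists i, (i != l) && (a i != 0%N)].
  by rewrite /mmap1 (bigD1 i) //= /axis (negbTE il) expr0n (negbTE ai) mul0r mulr0.
rewrite negb_exists => /forallP ha.
have -> : (a : multinom n) = mnm_muln (mnm1 l) (a l).
  apply/mnmP => i; rewrite mulmnE mnm1E eq_sym; have := ha i.
  by have [->|il] := eqVneq i l; rewrite ?mul1n //= negbK mul0n => /eqP.
rewrite h ?mul0r //; apply: leq_ltn_trans (bmdeg a).
by rewrite mdegE (bigD1 l) //= leq_addr.
Qed.

Lemma bigO_axis n (l : 'I_n) i : bigO 1 (fun z : 'I_1 -> C => axis l (z ord0) i).
Proof. by rewrite /axis; case: (i == l); [apply: bigO_proj | apply: bigO_zero]. Qed.

Lemma bigO_vanishing_order (g : C -> R) k :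
  bigO k (fun z : 'I_1 -> C => (g (z ord0))%:C) ->
  ((k%:R : R)%:E <= vanishing_order g)%E.
Proof.
move=> [K [d [d0 h]]]; apply: ereal_sup_ubound; exists k; split=> //.
exists K, d; split=> // t td.
by have := h (fun=> t) (fun=> td); rewrite normc_real /vnorm big_ord1.
Qed.

(** A vanishing order of 2 or more would give s <= const * s^2 for small real s > 0. *)
Lemma vanishing_order1 (g : C -> R) K1 K2 d :
  0 < d -> (forall t, normc t < d -> `|g t| <= K1 * normc t) ->
  (forall t, normc t < d -> normc t <= K2 * `|g t|) ->
  vanishing_order g = 1%:E.
Proof.
move=> d0 h1 h2; apply/eqP; rewrite eq_le; apply/andP; split; last first.
  by apply: ereal_sup_ubound; exists 1%N; split=> //; exists K1, d; split.
apply: ge_ereal_sup => _ [k [-> [K [e [e0 h]]]]].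
rewrite lee_fin lern1 leqNgt; apply/negP => k2.
pose B := `|K2| * `|K| + 1.
have B0 : 0 < B by rewrite ltr_wpDl ?mulr_ge0.
pose s := Num.min (Num.min d e) (Num.min 1 B^-1) / 2.
have m0 : 0 < Num.min (Num.min d e) (Num.min 1 B^-1).
  by rewrite !lt_min d0 e0 ltr01 invr_gt0.
have s0 : 0 < s by rewrite divr_gt0.
have : s < Num.min (Num.min d e) (Num.min 1 B^-1).
  by rewrite ltr_pdivrMr // mulr_natr mulr2n ltrDl.
rewrite !lt_min => /andP[/andP[sd se] /andP[s1 sB]].
have ns : normc s%:C = s by rewrite normc_real gtr0_norm.
have := h2 s%:C; have := h s%:C; rewrite ns => /(_ se) ha /(_ sd) hb.
have : s <= `|K2| * (`|K| * s ^+ 2).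
  apply: le_trans hb _; apply: le_trans (ler_wpM2r (normr_ge0 _) (ler_norm _)) _.
  rewrite ler_wpM2l //; apply: le_trans ha _.
  apply: le_trans (ler_wpM2r (exprn_ge0 _ (ltW s0)) (ler_norm _)) _.
  rewrite ler_wpM2l // -(subnKC k2) exprD ler_piMr ?exprn_ge0 ?(ltW s0) //.
  by rewrite exprn_ile1 ?ltW.
have -> : `|K2| * (`|K| * s ^+ 2) = s * ((`|K2| * `|K|) * s) by ring.
rewrite ler_pMr // leNgt => /negP; apply.
have : B * s < 1 by rewrite mulrC -ltr_pdivlMr // div1r.
by apply: le_lt_trans; rewrite ler_wpM2r ?(ltW s0) // lerDl ler01.
Qed.

(* sos f vanishes along the image under T of the l-th coordinate axis to twice the
   smallest order k of the u_j on that axis, and the curve has order 1. *)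
Lemma finite_type_bound n N (f : 'I_N -> ('I_n.+1 -> C) -> C) :
  (dangelo_type (sos f) < +oo)%E ->
  exists B : nat, forall (T S : n.-tuple (mpoly n C)) u (l : 'I_n),
    cst_free T -> cst_free S ->
    (forall z i, poly_map S (poly_map T z) i = z i) ->
    (forall j, holo_taylor (fun z => f j (append_var (poly_map T z) 0)) (u j)) ->
    exists j k, (k <= B)%N /\ u j (mnm_muln (mnm1 l) k) != 0.
Proof.
move=> fin; have [B hB] : exists B : nat, (dangelo_type (sos f) <= (B%:R : R)%:E)%E.
  case: (dangelo_type _) fin => [r| |] // _; last by exists 0%N; rewrite leNye.
  exists (Num.bound `|r|); rewrite lee_fin (le_trans (ler_norm _)) //.
  exact/ltW/archi_boundP.
exists B => T S u l hT hS ST hu; apply: contrapT => hn.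
have u0 j k : (k < B.+1)%N -> u j (mnm_muln (mnm1 l) k) = 0.
  by move=> kB; apply/eqP; apply: contrapT => /negP ne; apply: hn; exists j, k.
pose phi t := append_var (poly_map T (axis l t)) 0.
have [K1 [d1 [K10 d10 h1]]] := bigO_vnorm (fun i => bigO_poly i hT).
have [K2 [d2 [K20 d20 h2]]] := bigO_vnorm (fun i => bigO_poly i hS).
have up t : normc t < d1 -> vnorm (phi t) <= K1 * normc t.
  move=> td; rewrite vnorm_append0 -(vnorm_axis l t); apply: h1 => i.
  exact: le_lt_trans (normc_axis _ _ _) td.
pose d := Num.min d1 (d2 / (K1 + 1)).
have d0 : 0 < d by rewrite lt_min d10 divr_gt0 // ltr_wpDl.
have [dd1 dd2] : (d <= d1) /\ (d <= d2 / (K1 + 1)) by rewrite !ge_min !lexx orbT.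
(* The left inverse S bounds |t| by a multiple of |phi t|; this makes the order of the curve exactly
   1 and the curve nonconstant. *)
have low t : normc t < d -> normc t <= K2 * vnorm (phi t).
  move=> td; rewrite vnorm_append0 -{1}(vnorm_axis l t).
  have -> : vnorm (axis l t) = vnorm (poly_map S (poly_map T (axis l t))).
    by apply: eq_bigr => i _; rewrite ST.
  apply: h2 => i; apply: le_lt_trans (normc_le_vnorm _ i) _.
  rewrite -vnorm_append0; apply: le_lt_trans (up t (lt_le_trans td dd1)) _.
  have : normc t * (K1 + 1) < d2.
    by rewrite -ltr_pdivlMr ?(lt_le_trans td) // ltr_wpDl.
  by apply: le_lt_trans; rewrite mulrDr mulr1 mulrC lerDl normc_ge0.
have ord1 : vanishing_order (fun t => vnorm (phi t)) = 1%:E.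
  apply: (vanishing_order1 (K1 := K1) (K2 := K2) d0) => t td;
    rewrite ger0_norm ?vnorm_ge0 ?low //.
  by apply: up; apply: lt_le_trans dd1.
have germ : nonconstant_curve_germ phi.
  split.
  - move=> i; pose q : mpoly 1 C := append_var (fun k => tnth T k \mPo
      [tuple if k' == l then mpolyX C (mnm1 ord0) else 0 | k' < n]) 0 i.
    have -> : (fun x : 'I_1 -> C => phi (x ord0) i) = (fun x => meval x q).
      apply: funext => x; rewrite /phi /q /append_var.
      case: (unlift ord_max i) => [k|]; last by rewrite meval0.
      rewrite comp_mpoly_meval; apply: meval_eq => k'; rewrite tnth_mktuple /axis.
      by case: (k' == l); rewrite ?mevalXU ?meval0.
    exact: holomorphic_meval.
  - move=> i; apply: eq0_normc; apply/eqP; rewrite eq_le normc_ge0 andbT.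
    apply: le_trans (normc_le_vnorm (phi 0) i) _.
    by have := up 0; rewrite normc0 mulr0; apply.
  - move=> e e0; pose s := Num.min e d / 2.
    have m0 : 0 < Num.min e d by rewrite lt_min e0 d0.
    have s0 : 0 < s by rewrite divr_gt0.
    have : s < Num.min e d by rewrite ltr_pdivrMr // mulr_natr mulr2n ltrDl.
    have ns : normc s%:C = s by rewrite normc_real gtr0_norm.
    rewrite lt_min => /andP[se sd]; exists s%:C; rewrite ns; split=> //.
    apply: contrapT => hz; have := low s%:C; rewrite ns => /(_ sd).
    rewrite /vnorm big1 ?mulr0 ?leNgt ?s0 // => i _.
    have [->|ne] := eqVneq (phi s%:C i) 0; first by rewrite normc0.
    by case: hz; exists i.
have : (vanishing_order (fun t => sos f (phi t)) <= (B%:R : R)%:E)%E.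
  apply: le_trans hB; apply: ereal_sup_ubound; exists phi; split=> //.
  by rewrite ord1 /= invr1 mule1.
apply/negP; rewrite -ltNge; apply: (@lt_le_trans _ _ ((B.+1%:R : R)%:E)).
  by rewrite lte_fin ltr_nat.
apply: bigO_vanishing_order.
have hO j : bigO B.+1 (fun z : 'I_1 -> C => f j (phi (z ord0))).
  have := bigO_comp (bigO_axis l) (hu j B.+1).
  by apply: bigO_ext => z; rewrite (psum_axis _ (u0 j)) subr0.
have : bigO B.+1 (fun z : 'I_1 -> C =>
    \sum_j f j (phi (z ord0)) * (f j (phi (z ord0)))^*).
  (* The squares vanish to order 2(B + 1), but order B + 1 already contradicts the bound B on the
     type. *)
  apply: bigO_sum => j _; apply: (@bigO_le _ _ (B.+1 + B.+1)); first exact: leq_addr.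
  by apply: bigO_mul => //; apply: bigO_conj.
have phi_max t : phi t ord_max = 0 by rewrite /phi append_var_max.
apply: bigO_ext => z; rewrite /sos phi_max mulr0 add0r.
by rewrite rmorph_sum; apply: eq_bigr => j _; rewrite -sqr_normc_mul.
Qed.

End CurveOrder.

(** * Homogeneous transformations *)

Section HomogeneousTransformations.
Variable R : realType.
Local Notation C := R[i].

Lemma wdeg_ge n (L : 'I_n -> rat) tau a : (forall i, tau <= L i) ->
  (mdeg a)%:R * tau <= wdeg L a.
Proof.
move=> h; rewrite -wdeg_cst; apply: ler_sum => i _.
by rewrite ler_wpM2l.
Qed.

(** A positive lower bound on the weights leaves finitely many monomials of a given weight, so that
    weighted parts of power series are polynomials. *)
Lemma wdeg_bounded n (L : 'I_n -> rat) tau kappa : 0 < tau ->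
  (forall i, tau <= L i) ->
  exists k, forall a : multinom n, wdeg L a <= kappa -> (mdeg a < k)%N.
Proof.
move=> tau0 h; exists (Num.bound `|kappa / tau|) => a ha.
rewrite -(ltr_nat rat); apply: le_lt_trans _ (archi_boundP (normr_ge0 _)).
apply: le_trans (ler_norm _); rewrite ler_pdivlMr //.
exact: le_trans (wdeg_ge a h) ha.
Qed.

Lemma wpart_exists n (L : 'I_n -> rat) tau kappa (c : multinom n -> C) :
  0 < tau -> (forall i, tau <= L i) -> exists P, is_wpart L kappa c P.
Proof.
move=> tau0 /(wdeg_bounded kappa tau0)[k hk].
exists (trunc (fun a => if wdeg L a == kappa then c a else 0) k) => a.
rewrite mcoeff_trunc; case: ifP => // h; case: eqP => // e.
by rewrite hk ?e in h.
Qed.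

Lemma wparts_exist n N (L : 'I_n -> rat) tau kappa (c : 'I_N -> multinom n -> C) :
  0 < tau -> (forall i, tau <= L i) ->
  exists P, forall j, is_wpart L kappa (c j) (P j).
Proof.
move=> tau0 h.
by have [P hP] := choice (fun j => wpart_exists kappa (c j) tau0 h); exists P.
Qed.

Lemma double_weight_ge n (L : 'I_n -> rat) tau : (forall i, tau <= L i) ->
  forall i, tau <= double_weight L i.
Proof. by move=> h i; rewrite /double_weight; case: (fintype.split i). Qed.

Lemma whomogeneous_cst_free n (L : 'I_n -> rat) (T : n.-tuple (mpoly n C)) :
  (forall i, 0 < L i) -> (forall i, whomogeneous L (L i) (tnth T i)) -> cst_free T.
Proof.
move=> L0 hT i; apply/eqP; apply: contraT => /hT; rewrite wdeg0 => e.
by have := L0 i; rewrite -e ltxx.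
Qed.

Lemma poly_map_comp n (T U : n.-tuple (mpoly n C)) z i :
  poly_map (comp_map T U) z i = poly_map T (poly_map U z) i.
Proof. by rewrite /poly_map tnth_mktuple comp_mpoly_meval. Qed.

Lemma poly_map_id n (z : 'I_n -> C) i : poly_map (id_map R n) z i = z i.
Proof. by rewrite /poly_map tnth_mktuple mevalXU. Qed.

Lemma comp_mapP n (T U : n.-tuple (mpoly n C)) :
  comp_map T U = id_map R n <->
  forall z i, poly_map T (poly_map U z) i = z i.
Proof.
split=> [h z i|h]; first by rewrite -poly_map_comp h poly_map_id.
apply: eq_from_tnth => i; apply: mpoly_ext => z.
by rewrite -[LHS]/(poly_map _ z i) -[RHS]/(poly_map _ z i) poly_map_comp h poly_map_id.
Qed.

Lemma cst_free_comp n (T U : n.-tuple (mpoly n C)) :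
  cst_free T -> cst_free U -> cst_free (comp_map T U).
Proof.
move=> hT hU i; apply/eqP; apply: contraT; rewrite tnth_mktuple.
move=> /(mdeg_comp hU)[a []]; rewrite mdeg0 leqn0 mdeg_eq0 => ha /eqP a0.
by move: ha; rewrite a0 hT eqxx.
Qed.

Section Inverse.
Variables (n : nat) (L : 'I_n -> rat) (S U : n.-tuple (mpoly n C)).
Hypothesis hSU : homogeneous_transformation L S U.

Lemma homogeneous_map i : whomogeneous L (L i) (tnth S i).
Proof.
have [/(_ i)[phi [hphi ->]] _ _] := hSU.
by apply: whomogeneousD => //; apply: whomogeneousX.
Qed.

(* Write U_i = p + r with p the part of weight L_i. Then r o S = X_i - p o S has
   weight L_i, while all weights of r o S are those of r; so r o S = 0. *)
Lemma homogeneous_inverse i : whomogeneous L (L i) (tnth U i).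
Proof.
have [_ /comp_mapP SU US] := hSU.
set q := tnth U i.
pose r : mpoly n C :=
  trunc (fun a => if wdeg L a == L i then 0 else mcoeff a q) (msize q).
have rE a : mcoeff a r = if wdeg L a == L i then 0 else mcoeff a q.
  rewrite mcoeff_trunc; case: ltnP => // /mcoeff_gt_msize ->.
  by rewrite if_same.
have hp : whomogeneous L (L i) (q - r).
  move=> a; rewrite mcoeffB rE; case: (wdeg L a =P L i) => // _.
  by rewrite subrr eqxx.
have qS : q \mPo S = mpolyX C (mnm1 i).
  by have := congr1 (fun T => tnth T i) US; rewrite !tnth_mktuple.
have rS0 : r \mPo S = 0.
  apply/mpolyP => b; rewrite mcoeff0; apply/eqP; apply: contraT => hb.
  have hr : whomogeneous L (L i) (r \mPo S).
    have -> : r \mPo S = mpolyX C (mnm1 i) - ((q - r) \mPo S).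
      by rewrite -qS raddfB subKr.
    apply: whomogeneousD; first exact: whomogeneousX.
    move=> a; rewrite mcoeffN oppr_eq0.
    exact: (whomogeneous_comp homogeneous_map hp).
  have [||k c|a [ha e]] := @mcoeff_comp_rel _ _ _ L L eq _ _ S _ r b hb => //.
  - by move=> ? ? ? ? -> ->.
  - by move=> /homogeneous_map ->.
  - by move: ha; rewrite rE e (hr b hb) !eqxx.
have r0 : r = 0.
  apply: mpoly_points0 => z; rewrite -(@meval_eq _ _ _ _ r (SU z)).
  by rewrite -[LHS]comp_mpoly_meval rS0 meval0.
by move: hp; rewrite r0 subr0.
Qed.

End Inverse.

Arguments homogeneous_map {n L S U} hSU i.
Arguments homogeneous_inverse {n L S U} hSU i.

Lemma homogeneous_transformation_id n (L : 'I_n -> rat) :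
  homogeneous_transformation L (id_map R n) (id_map R n).
Proof.
have id_id : comp_map (id_map R n) (id_map R n) = id_map R n.
  by apply/comp_mapP => z i; rewrite !poly_map_id.
split=> // i; exists 0; split; first exact: whomogeneous0.
by rewrite tnth_mktuple addr0.
Qed.

Lemma homogeneous_transformation_comp n (L : 'I_n -> rat) S U S' U' :
  @homogeneous_transformation R n L S U -> homogeneous_transformation L S' U' ->
  homogeneous_transformation L (comp_map S' S) (comp_map U U').
Proof.
move=> h h'; have [hS /comp_mapP SU /comp_mapP US] := h.
have [hS' /comp_mapP SU' /comp_mapP US'] := h'; split.
- move=> i; exists (tnth (comp_map S' S) i - mpolyX C (mnm1 i)).
  split; last by rewrite addrC subrK.
  apply: whomogeneousD.
    by rewrite tnth_mktuple; apply: whomogeneous_comp (homogeneous_map h) (homogeneous_map h' i).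
  move=> a; rewrite mcoeffN oppr_eq0; exact: whomogeneousX.
- apply/comp_mapP => z i; rewrite poly_map_comp.
  rewrite -[RHS]SU'; apply: meval_eq => k.
  by rewrite -[RHS](SU (poly_map U' z) k); apply: meval_eq => l; apply: poly_map_comp.
- apply/comp_mapP => z i; rewrite poly_map_comp.
  rewrite -[RHS]US; apply: meval_eq => k.
  by rewrite -[RHS](US' (poly_map S z) k); apply: meval_eq => l; apply: poly_map_comp.
Qed.

End HomogeneousTransformations.

Arguments homogeneous_map {R n L S U} hSU i.
Arguments homogeneous_inverse {R n L S U} hSU i.

(** * Independence of a variable, and weighted parts under substitution *)

Section Independence.
Variable R : realType.
Local Notation C := R[i].

Definition kill n (i : 'I_n) (z : 'I_n -> C) : 'I_n -> C :=
  fun k => if k == i then 0 else z k.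

Lemma independent_meval n (p : mpoly n C) (i : 'I_n) :
  (forall a, mcoeff a p != 0 -> a i = 0%N) -> independent_of (fun z => meval z p) i.
Proof.
move=> h z z' e; rewrite !(meval_sum _ (leqnn _)); apply: eq_bigr => a _.
have [->|/h ai] := eqVneq (mcoeff a p) 0; first by rewrite !mul0r.
congr (_ * _); apply: eq_bigr => k _.
by have [->|/e ->] := eqVneq k i; rewrite // ai !expr0.
Qed.

(** Independence of x_i gives p = p with x_i set to 0. The weight that is 1 on x_i and 0 elsewhere
    reads off the exponent of x_i, which vanishes on every monomial of the substituted
    polynomial. *)
Lemma mcoeff_independent n (p : mpoly n C) (i : 'I_n) :
  independent_of (fun z => meval z p) i -> forall a, mcoeff a p != 0 -> a i = 0%N.
Proof.
move=> h a.
pose T : n.-tuple (mpoly n C) :=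
  [tuple if k == i then 0 else mpolyX C (mnm1 k) | k < n].
have -> : p = p \mPo T.
  apply: mpoly_ext => z; rewrite comp_mpoly_meval; apply: h => k /negbTE ki.
  by rewrite tnth_mktuple ki mevalXU.
move=> ha; pose w (k : 'I_n) : rat := (k == i)%:R.
have [||k b|b [_ e]] := @mcoeff_comp_rel _ _ _ w w (fun _ y => y = 0) _ _ T _ p a ha => //.
- by move=> ? ? ? ? -> ->.
- rewrite tnth_mktuple; case: ifP => ki; first by rewrite mcoeff0 eqxx.
  rewrite mcoeffX; have [<- _|] := eqVneq (mnm1 k) b; last by rewrite eqxx.
  by rewrite wdeg1 /w ki.
apply/eqP; rewrite -(eqr_nat rat); apply/eqP; rewrite -[RHS]e /wdeg (bigD1 i) //=.
rewrite /w eqxx mulr1 big1 ?addr0 // => k /negbTE ->.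
by rewrite mulr0.
Qed.

(* The diagonal coefficients [sum_j |g_(j,a)|^2] of [sum_j |g_j|^2] detect all
   the coefficients of the g_j. *)
Lemma independent_sos n N (g : 'I_N -> mpoly n C) (i : 'I_n) :
  independent_of (fun z => (\sum_j normc (meval z (g j)) ^+ 2)%:C) i ->
  forall j, independent_of (fun z => meval z (g j)) i.
Proof.
move=> h j; apply: independent_meval => a; apply: contra_neq_eq => ai.
suff /sosc_diag_eq0 : sosc (fun j b => mcoeff b (g j)) (mjoin a a) = 0 by apply.
rewrite -mcoeff_sosp.
pose T : (n + n).-tuple (mpoly (n + n) C) :=
  [tuple if (k == lshift n i) || (k == rshift n i) then 0
   else mpolyX C (mnm1 k) | k < n + n].
have TE z k : meval (zzbar z) (tnth T k) = zzbar (kill i z) k.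
  rewrite tnth_mktuple; have := splitK k; case: (fintype.split k) => l <- /=.
    rewrite zzbar_lshift /kill eq_lrshift orbF (inj_eq (@lshift_inj _ _)).
    by case: eqP; rewrite ?meval0 // mevalXU zzbar_lshift.
  rewrite zzbar_rshift /kill eq_rlshift (inj_eq (@rshift_inj _ _)).
  by case: eqP => _; rewrite ?meval0 ?rmorph0 // mevalXU zzbar_rshift.
(* Independence is known only at the points (z, conj z); [mpoly_zzbar0] lifts the equality to
   polynomials in 2n free variables, where z_i alone can be examined. *)
have e : sosp g = sosp g \mPo T.
  apply/eqP; rewrite -subr_eq0; apply/eqP/mpoly_zzbar0 => z.
  rewrite mevalB comp_mpoly_meval (meval_eq _ (TE z)) !meval_sosp.
  apply/eqP; rewrite subr_eq0; apply/eqP; apply: h => k /negbTE ki.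
  by rewrite /kill ki.
apply/eqP; apply: contraT => hc; case/eqP: ai.
rewrite -(mjoin_lshift a a i); apply: mcoeff_independent hc => z z' hz.
rewrite e !comp_mpoly_meval; apply: meval_eq => k; rewrite !tnth_mktuple.
case: ifP => [|/negbT]; first by rewrite !meval0.
by rewrite negb_or => /andP[kl _]; rewrite !mevalXU hz.
Qed.

Lemma wpart_sosp n N (L : 'I_n -> rat) (u : 'I_N -> multinom n -> C) h P :
  (forall j a, u j a != 0 -> 2^-1 <= wdeg L a) ->
  (forall j, is_wpart L 2^-1 (u j) (h j)) ->
  is_wpart (double_weight L) 1 (sosc u) P -> P = sosp h.
Proof.
move=> hu hh hP; apply/mpolyP => c; rewrite hP mcoeff_sosp.
rewrite -{1}(mjoin_eta c) wdeg_join; set a := mleft c; set b := mright c.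
have [e|e] := eqVneq (wdeg L a) 2^-1; have [e'|e'] := eqVneq (wdeg L b) 2^-1.
- rewrite e e' (_ : _ == _) //; apply: eq_bigr => j _.
  by rewrite -/a -/b !hh e e' eqxx.
- rewrite [RHS]big1 => [|j _]; last by rewrite -/b (hh _ b) (negbTE e') rmorph0 mulr0.
  by rewrite ifN // e; apply: contra e' => /eqP s; apply/eqP; lra.
- rewrite [RHS]big1 => [|j _]; last by rewrite -/a (hh _ a) (negbTE e) mul0r.
  by rewrite ifN // e'; apply: contra e => /eqP s; apply/eqP; lra.
- rewrite [RHS]big1 => [|j _]; last by rewrite -/a (hh _ a) (negbTE e) mul0r.
  case: eqP => // s; rewrite /sosc big1 // => j _; rewrite -/a -/b.
  have [->|ua] := eqVneq (u j a) 0; first by rewrite mul0r.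
  have [->|ub] := eqVneq (u j b) 0; first by rewrite rmorph0 mulr0.
  by case/eqP: e; have := hu _ _ ua; have := hu _ _ ub; lra.
Qed.

(** A homogeneous substitution preserves weights, hence commutes with the extraction of a weighted
    part. *)
Lemma wpart_comp n (L : 'I_n -> rat) kappa (u : multinom n -> C) h S U :
  homogeneous_transformation L S U -> cst_free U ->
  is_wpart L kappa u h -> is_wpart L kappa (comp_coef U u) (h \mPo U).
Proof.
move=> hU fU hh b.
have hhom : whomogeneous L kappa h.
  by move=> a; rewrite hh; case: (wdeg L a =P kappa) => // _; rewrite eqxx.
have uhom := homogeneous_inverse hU.
case: (wdeg L b =P kappa) => [e|ne]; last first.
  by apply/eqP; apply: contraT => /(whomogeneous_comp uhom hhom).
(* Q reaches beyond |b|, as [comp_coefE] requires, and beyond the degree of h, so that Q - h has no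
   term of weight kappa. *)
pose Q := trunc u ((mdeg b).+1 + msize h).
rewrite (comp_coefE (Q := Q) fU) => [|a ab]; last first.
  by rewrite mcoeff_trunc ltn_addr.
apply/eqP; rewrite eq_sym -subr_eq0 -mcoeffB -raddfB; apply: contraT => hb.
have [||k c|a [ha e']] := @mcoeff_comp_rel _ _ _ L L eq _ _ U _ _ b hb => //.
- by move=> ? ? ? ? -> ->.
- by move=> /uhom ->.
move: ha; have := hh a; rewrite mcoeffB mcoeff_trunc e' e eqxx => {1}<-.
by case: ltnP => [_|hm]; rewrite ?subrr ?eqxx // mcoeff_gt_msize ?subrr ?eqxx //
  (leq_trans _ hm) // leq_addl.
Qed.

Lemma comp_coef_weight n (L : 'I_n -> rat) (u : multinom n -> C) S U b :
  homogeneous_transformation L S U -> comp_coef U u b != 0 ->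
  exists a, u a != 0 /\ wdeg L a = wdeg L b.
Proof.
move=> hU hb; have uhom := homogeneous_inverse hU.
have [||k c|a [ha e]] := @mcoeff_comp_rel _ _ _ L L eq _ _ U _ _ b hb => //.
- by move=> ? ? ? ? -> ->.
- by move=> /uhom ->.
by exists a; split=> //; move: ha; rewrite mcoeff_trunc; case: ifP; rewrite ?eqxx.
Qed.

End Independence.

(** * Stages of the algorithm *)

Section Stages.
Variable R : realType.
Local Notation C := R[i].
Variables (n N : nat) (f : 'I_N -> ('I_n.+1 -> C) -> C).

(** The invariant of a stage, in its chosen coordinates and on z_(n+1) = 0. It is phrased through
    the series u_j of the f_j rather than through P_t: [stage_ge] and [stage_tail] are the weight
    bound and the absence of tail variables in the parts of weight 1/2. [stage_max] keeps the
    maximality of d, which the next stage needs. *)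
Record stage_data (T : n.-tuple (mpoly n C)) (L : 'I_n -> rat) (d : nat)
    (u : 'I_N -> multinom n -> C) : Prop := StageData {
  stage_dim : (d <= n)%N;
  stage_weight : exists tau, [/\ 0 < tau, forall i, tau <= L i
    & forall i : 'I_n, (n - d <= i)%N -> L i = tau];
  stage_cst_free : cst_free T;
  stage_inverse : exists S, cst_free S /\
    forall z i, poly_map S (poly_map T z) i = z i;
  stage_taylor : forall j,
    holo_taylor (fun z => f j (append_var (poly_map T z) 0)) (u j);
  stage_ge : forall j a, u j a != 0 -> 2^-1 <= wdeg L a;
  stage_tail : forall j a, u j a != 0 -> wdeg L a = 2^-1 ->
    forall i : 'I_n, (n - d <= i)%N -> a i = 0%N;
  stage_max : forall h S' U' (A : {set 'I_n}),
    (forall j, is_wpart L 2^-1 (u j) (h j)) ->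
    homogeneous_transformation L S' U' ->
    (forall i, i \in A -> forall j,
      independent_of (fun z => meval (poly_map U' z) (h j)) i) ->
    (#|A| <= d)%N
}.

Lemma transformed_sosp (h : 'I_N -> mpoly n C) (U : n.-tuple (mpoly n C)) :
  transformed (sosp h) U =
    (fun z => (\sum_j normc (meval z (h j \mPo U)) ^+ 2)%:C).
Proof.
apply: funext => z; rewrite /transformed meval_sosp; congr (_%:C).
by apply: eq_bigr => j _; rewrite comp_mpoly_meval.
Qed.

Lemma independent_transformed (h : 'I_N -> mpoly n C) U i :
  independent_of (transformed (sosp h) U) i <->
  forall j, independent_of (fun z => meval (poly_map U z) (h j)) i.
Proof.
rewrite transformed_sosp; split=> [/independent_sos H j z z' e|H z z' e].
  by have := H j z z' e; rewrite !comp_mpoly_meval.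
congr (_%:C); apply: eq_bigr => j _; rewrite !comp_mpoly_meval.
by congr (normc _ ^+ 2); apply: H.
Qed.

Lemma is_wpart_unique m (w : 'I_m -> rat) k c (P Q : mpoly m C) :
  is_wpart w k c P -> is_wpart w k c Q -> P = Q.
Proof. by move=> hP hQ; apply/mpolyP => a; rewrite hP hQ. Qed.

(** Common to the first and the later stages: u describes the f_j in the coordinates T, before the
    transformation U of the stage. *)
Lemma stage_data_best T S L tau P U d u :
  0 < tau -> (forall i, tau <= L i) ->
  (forall i : 'I_n, (n - d <= i)%N -> L i = tau) ->
  cst_free T -> cst_free S ->
  (forall z i, poly_map S (poly_map T z) i = z i) ->
  (forall j, holo_taylor (fun z => f j (append_var (poly_map T z) 0)) (u j)) ->
  (forall j a, u j a != 0 -> 2^-1 <= wdeg L a) ->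
  is_wpart (double_weight L) 1 (sosc u) P ->
  best_transformation L P U d ->
  stage_data (comp_map T U) L d (fun j => comp_coef U (u j)).
Proof.
move=> tau0 hL tail fT fS ST hu ge hP [dn [S1 hU] indep best].
have [h hh] := wparts_exist 2^-1 u tau0 hL.
have PE := wpart_sosp ge hh hP.
have Lpos i : 0 < L i by apply: lt_le_trans (hL i).
have fU : cst_free U := whomogeneous_cst_free Lpos (homogeneous_inverse hU).
have fS1 : cst_free S1 := whomogeneous_cst_free Lpos (homogeneous_map hU).
have [_ /comp_mapP SU /comp_mapP US] := hU.
have hh' j : is_wpart L 2^-1 (comp_coef U (u j)) (h j \mPo U).
  exact: wpart_comp hU fU (hh j).
split=> //.
- by exists tau.
- exact: cst_free_comp.
- exists (comp_map S1 S); split; first exact: cst_free_comp.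
  move=> z i; rewrite poly_map_comp -[RHS]SU; apply: meval_eq => k.
  by rewrite -[RHS]ST; apply: meval_eq => l; rewrite poly_map_comp.
- move=> j; apply: holo_taylor_ext (holo_taylor_comp fU (hu j)) => z.
  congr (f j (append_var _ 0)); apply: funext => i.
  by rewrite poly_map_comp.
- move=> j b /(comp_coef_weight hU)[a [/ge]].
  by move=> + <-.
- move=> j a ha wa i ni.
  have := hh' j a; rewrite wa eqxx => ea.
  have := indep i ni; rewrite PE => /independent_transformed /(_ j) H.
  apply: (@mcoeff_independent _ _ (h j \mPo U) i); last by rewrite ea.
  by move=> z z' e; rewrite !comp_mpoly_meval; apply: H.
- move=> h' S' U' A hh'' hU' hA.
  (* A transformation of the new coordinates, composed with U, competes with U in the old ones. *)
  apply: (best _ _ _ (homogeneous_transformation_comp hU hU')) => i /hA Hi.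
  rewrite PE; apply/independent_transformed => j z z' e.
  have E y : meval (poly_map (comp_map U U') y) (h j) = meval (poly_map U' y) (h' j).
    rewrite (is_wpart_unique (hh'' j) (hh' j)) comp_mpoly_meval.
    by apply: meval_eq => k; apply: poly_map_comp.
  by rewrite !E; apply: Hi.
Qed.

Lemma card_tail d : (d <= n)%N -> #|[set i : 'I_n | (n - d <= i)%N]%SET| = d.
Proof.
move=> dn; have lt (k : 'I_d) : (n - d + k < n)%N by have := ltn_ord k; lia.
have -> : [set i : 'I_n | (n - d <= i)%N]%SET = [set Ordinal (lt k) | k : 'I_d]%SET.
  apply/setP => i; rewrite inE; apply/idP/imsetP => [h|[k _ ->]]; last by rewrite /= leq_addr.
  have hk : (i - (n - d) < d)%N by have := ltn_ord i; lia.
  by exists (Ordinal hk) => //; apply: val_inj; rewrite /= subnKC.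
rewrite card_imset ?card_ord // => k l /(congr1 val) /= /addnI e.
exact: val_inj.
Qed.

(** * Two consecutive stages: head weights kept, tail weight lowered *)

Section HeadFixed.
Variables (T : n.-tuple (mpoly n C)) (L L' : 'I_n -> rat) (d : nat)
  (u : 'I_N -> multinom n -> C) (tau' : rat).
Hypothesis hT : stage_data T L d u.
Hypothesis headL' : forall i : 'I_n, (i < n - d)%N -> L' i = L i.
Hypothesis tailL' : forall i : 'I_n, (n - d <= i)%N -> L' i = tau'.
Hypothesis tau'_gt0 : 0 < tau'.
Hypothesis tau'_lt : forall i, tau' < L i.

Let restr (z : 'I_n -> C) : 'I_n -> C := fun i => if (i < n - d)%N then z i else 0.
Let rho : n.-tuple (mpoly n C) :=
  [tuple if (i < n - d)%N then mpolyX C (mnm1 i) else 0 | i < n].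
(** Q with the tail set to 0 on the head variables, the identity on the tail. The lowered tail
    weight no longer matters for such a map, and the identity on the tail keeps it invertible. *)
Let cut (Q : n.-tuple (mpoly n C)) : n.-tuple (mpoly n C) :=
  [tuple if (i < n - d)%N then tnth Q i \mPo rho else mpolyX C (mnm1 i) | i < n].

Let poly_map_rho z i : poly_map rho z i = restr z i.
Proof.
by rewrite /poly_map tnth_mktuple /restr; case: ifP; rewrite ?mevalXU ?meval0.
Qed.

Let poly_map_cut Q z i :
  poly_map (cut Q) z i = if (i < n - d)%N then poly_map Q (restr z) i else z i.
Proof.
rewrite /poly_map tnth_mktuple; case: ifP => hi; last by rewrite mevalXU.
by rewrite comp_mpoly_meval; apply: meval_eq => k; apply: poly_map_rho.
Qed.

(* Tail variables have the smallest weight, so the tail components of a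
   homogeneous map are linear in the tail variables. *)
Let tail_zero Q (i : 'I_n) z : (forall k, whomogeneous L' (L' k) (tnth Q k)) ->
  (n - d <= i)%N -> poly_map Q (restr z) i = 0.
Proof.
move=> hQ ni; rewrite /poly_map (meval_sum _ (leqnn _)) /psum big1 // => a _.
have [->|/hQ] := eqVneq (mcoeff a (tnth Q i)) 0; first by rewrite mul0r.
have geL' k : tau' <= L' k.
  case: (ltnP k (n - d)) => hk; last by rewrite tailL'.
  by rewrite (headL' hk) ltW.
rewrite tailL' // => e.
have : mdeg a == 1%N.
  rewrite eqn_leq; apply/andP; split.
    rewrite -(ler_nat rat); have := wdeg_ge a geL'.
    by rewrite e ger_pMl.
  rewrite lt0n mdeg_eq0; apply/eqP => a0; move: e; rewrite a0 wdeg0 => e.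
  by move: tau'_gt0; rewrite -e ltxx.
move=> /mdeg1P[k /eqP ak]; move: e; rewrite ak wdeg1 => e.
rewrite mmap1U /restr; case: ifP => hk; last by rewrite mulr0.
by have := tau'_lt k; rewrite -headL' // e ltxx.
Qed.

Let restr_cut Q z (i : 'I_n) : (forall k, whomogeneous L' (L' k) (tnth Q k)) ->
  restr (poly_map (cut Q) z) i = poly_map Q (restr z) i.
Proof.
move=> hQ; rewrite {1}/restr poly_map_cut; case: (ltnP i (n - d)) => // hi.
by rewrite tail_zero.
Qed.

(** Q preserves the subspace where the tail vanishes, so restrictions to it compose as the original
    maps do. *)
Let cut_inverse P Q : (forall k, whomogeneous L' (L' k) (tnth Q k)) ->
  comp_map P Q = id_map R n -> comp_map (cut P) (cut Q) = id_map R n.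
Proof.
move=> hQ /comp_mapP PQ; apply/comp_mapP => z i.
rewrite poly_map_cut; case: ifP => hi; last by rewrite poly_map_cut hi.
transitivity (restr z i); last by rewrite /restr hi.
rewrite -[RHS]PQ; apply: meval_eq => k; exact: restr_cut.
Qed.

Let cut_homogeneous S U : homogeneous_transformation L' S U ->
  homogeneous_transformation L (cut S) (cut U).
Proof.
move=> hU; have [_ SU US] := hU; split; first last.
- exact: cut_inverse (homogeneous_map hU) US.
- exact: cut_inverse (homogeneous_inverse hU) SU.
move=> i; exists (tnth (cut S) i - mpolyX C (mnm1 i)).
split; last by rewrite addrC subrK.
apply: whomogeneousD; last first.
  by move=> a; rewrite mcoeffN oppr_eq0; apply: whomogeneousX.
rewrite tnth_mktuple; case: ifP => hi; last exact: whomogeneousX.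
rewrite -headL' //; apply: (@whomogeneous_comp _ _ _ L') (homogeneous_map hU i) => k.
rewrite tnth_mktuple; case: ifP => hk; last exact: whomogeneous0.
by rewrite headL' //; apply: whomogeneousX.
Qed.

(* Setting the tail variables to 0 turns an L'-homogeneous transformation into an
   L-homogeneous one of the head variables, and h_j into the part of weight 1/2
   at the previous stage; the maximality of d forbids a head variable in A. *)
Lemma independent_in_tail h S U (A : {set 'I_n}) :
  (forall j, is_wpart L' 2^-1 (u j) (h j)) ->
  homogeneous_transformation L' S U ->
  (forall i, i \in A -> forall j,
    independent_of (fun z => meval (poly_map U z) (h j)) i) ->
  forall i, i \in A -> (n - d <= i)%N.
Proof.
move=> hh hU hA i iA; rewrite leqNgt; apply/negP => hi.
have [tau [tau0 geL _]] := stage_weight hT.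
have [h0 hh0] := wparts_exist 2^-1 u tau0 geL.
(* Monomials of h0, of weight 1/2 at the earlier stage, contain no tail variable, and on such
   monomials the two weights agree; hence h0 is h with the tail set to 0. *)
have h0E j z : meval z (h0 j) = meval (restr z) (h j).
  rewrite (meval_sum z (leq_maxl (msize (h0 j)) (msize (h j)))).
  rewrite (meval_sum _ (leq_maxr (msize (h0 j)) (msize (h j)))).
  apply: eq_bigr => a _; rewrite hh0 hh.
  have [/existsP[k /andP[nk ak]]|] := boolP [exists k : 'I_n, (n - d <= k)%N && (a k != 0%N)].
    have -> : mmap1 (restr z) a = 0.
      by rewrite /mmap1 (bigD1 k) //= /restr ltnNge nk expr0n (negbTE ak) mul0r.
    rewrite mulr0; case: eqP => wa; last by rewrite mul0r.
    have [->|ua] := eqVneq (u j a) 0; first by rewrite mul0r.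
    by move: ak; rewrite (stage_tail hT ua wa).
  rewrite negb_exists => /forallP nt.
  have a0 (k : 'I_n) : (n - d <= k)%N -> a k = 0%N.
    by move=> nk; have := nt k; rewrite nk negbK => /eqP.
  have -> : mmap1 (restr z) a = mmap1 z a.
    apply: eq_bigr => k _; rewrite /restr; case: ltnP => // /a0 ->.
    by rewrite !expr0.
  have -> // : wdeg L' a = wdeg L a.
  apply: eq_bigr => k _; case: (ltnP k (n - d)) => [/headL' -> //|/a0 ->].
  by rewrite !mul0r.
(* The head variable i together with the whole tail would be d + 1 eliminated variables at the
   earlier stage. *)
have := stage_max hT (A := (i |: [set k : 'I_n | (n - d <= k)%N])%SET) hh0
  (cut_homogeneous hU).
have -> : #|(i |: [set k : 'I_n | (n - d <= k)%N])%SET| = d.+1.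
  by rewrite cardsU1 card_tail ?(stage_dim hT) // inE leqNgt hi.
rewrite ltnn => H; suff: false by [].
apply: H => k kA j z z' e.
have E y : meval (poly_map (cut U) y) (h0 j) = meval (poly_map U (restr y)) (h j).
  rewrite h0E; apply: meval_eq => l.
  exact: restr_cut (homogeneous_inverse hU).
rewrite !E; move: kA; rewrite !inE => /orP[/eqP ki|nk].
  by apply: (hA i iA j) => l li; rewrite /restr e ?ki.
apply: meval_eq => l; apply: meval_eq => l'; rewrite /restr; case: ifP => // hl'.
by apply: e; apply: contraTneq nk => <-; rewrite -ltnNge.
Qed.

End HeadFixed.

Definition tail_degree d (a : multinom (n + n)) : nat :=
  \sum_(i < n | (n - d <= i)%N) var_degree a i.

Lemma wdeg_head_tail (L : 'I_n -> rat) d tau a :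
  (forall i : 'I_n, (n - d <= i)%N -> L i = tau) ->
  wdeg (double_weight L) a = head_weight L d a + (tail_degree d a)%:R * tau.
Proof.
move=> hL; have -> : wdeg (double_weight L) a = \sum_i (var_degree a i)%:R * L i.
  rewrite -(mjoin_eta a) wdeg_join /wdeg -big_split; apply: eq_bigr => i _ /=.
  by rewrite /var_degree mjoin_lshift mjoin_rshift natrD mulrDl.
rewrite (bigID (fun i : 'I_n => (i < n - d)%N)) /=; congr (_ + _).
rewrite /tail_degree natr_sum mulr_suml; apply: eq_big => [i|i]; first by rewrite -leqNgt.
by rewrite -leqNgt => /hL ->.
Qed.

(** On Theta, head weight < 1 < head weight + tail degree * tau: so the denominator of W is
    positive, and the new tail weight drops strictly below tau. *)
Lemma Theta_tail (c : multinom (n + n) -> C) L d tau a :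
  0 < tau -> (forall i : 'I_n, (n - d <= i)%N -> L i = tau) -> Theta c L d a ->
  [/\ (0 < tail_degree d a)%N, 0 < Wratio L d a & Wratio L d a < tau].
Proof.
move=> tau0 tail [ca]; rewrite (wdeg_head_tail _ tail) => w1 h1.
have t0 : (0 < tail_degree d a)%N.
  rewrite lt0n; apply/eqP => t0; move: w1; rewrite t0 mul0r addr0 => /lt_trans /(_ h1).
  by rewrite ltxx.
have t0' : 0 < (tail_degree d a)%:R :> rat by rewrite ltr0n.
rewrite /Wratio -/(tail_degree d a); split=> //.
  by rewrite divr_gt0 // subr_gt0.
by rewrite ltr_pdivrMr // mulrC ltrBlDl.
Qed.

(** The diagonal index b = (al, al) is tested. If its head weight is at least 1, nothing is left to
    show. Otherwise b lies in Theta, its old weight being strictly above 1 by [stage_tail], and W(b)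
    <= W(a) rearranges to the bound. *)
Lemma next_weight_ge T L d u a :
  stage_data T L d u -> Theta (sosc u) L d a ->
  (forall b, Theta (sosc u) L d b -> Wratio L d b <= Wratio L d a) ->
  forall j al, u j al != 0 -> 2^-1 <= wdeg (next_weight L d (Wratio L d a)) al.
Proof.
move=> hT ha hmax j al ual.
have [tau [tau0 geL tail]] := stage_weight hT.
have [t0 W0 Wt] := Theta_tail tau0 tail ha.
set L' := next_weight _ _ _; set W := Wratio L d a in W0 Wt L' *.
have tailL' (i : 'I_n) : (n - d <= i)%N -> L' i = W.
  by rewrite /L' /next_weight ltnNge => ->.
pose b := mjoin al al.
have headE : head_weight L' d b = head_weight L d b.
  by apply: eq_bigr => i hi; rewrite /L' /next_weight hi.
have cb : sosc u b != 0.
  by apply/eqP => /sosc_diag_eq0 /(_ j) /eqP; rewrite (negbTE ual).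
suff : 1 <= wdeg (double_weight L') b by rewrite wdeg_join; lra.
rewrite (wdeg_head_tail _ tailL') headE.
have [h1|h1] := lerP 1 (head_weight L d b).
  by apply: ler_wpDr => //; rewrite mulr_ge0 // ltW.
have w1 : 1 < wdeg (double_weight L) b.
  rewrite lt_neqAle; have := stage_ge hT ual; rewrite wdeg_join => ge1.
  apply/andP; split; last lra.
  apply/eqP => e; have wal : wdeg L al = 2^-1 by lra.
  have : wdeg (double_weight L) b = head_weight L d b.
    rewrite (wdeg_head_tail _ tail) /tail_degree big1 ?mul0r ?addr0 // => i ni.
    by rewrite /var_degree mjoin_lshift mjoin_rshift (stage_tail hT ual wal).
  by rewrite wdeg_join -e => e'; rewrite -e' ltxx in h1.
have hb : Theta (sosc u) L d b by split.
have [tb0 _ _] := Theta_tail tau0 tail hb.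
have := hmax b hb; rewrite {1}/Wratio -/(tail_degree d b) ler_pdivrMr ?ltr0n //.
by rewrite -/W lerBlDl mulrC.
Qed.

End Stages.

(** * The variable z_(n+1): restriction to its zero set and extension of maps *)

Section LastVariable.
Variable R : realType.
Local Notation C := R[i].

Definition mnarrow n (a : multinom n.+1) : multinom n :=
  Multinom (mktuple (fun i => a (widen_ord (leqnSn n) i))).

Lemma mnarrowK n (a : multinom n.+1) : a ord_max = 0%N -> mnmwiden (mnarrow a) = a.
Proof.
move=> a0; apply/mnmP => i; case: (unliftP ord_max i) => [k ->|->].
  have -> : lift ord_max k = widen_ord (leqnSn n) k.
    by apply: val_inj; rewrite /= /bump leqNgt ltn_ord.
  by rewrite mnmwiden_widen mnmE.
by rewrite mnmwiden_ordmax.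
Qed.

Lemma mdeg_widen n (b : multinom n) : mdeg (mnmwiden b) = mdeg b.
Proof.
rewrite !mdegE big_ord_recr /= mnmwiden_ordmax addn0.
by apply: eq_bigr => i _; rewrite mnmwiden_widen.
Qed.

Lemma wdeg_full n (L : 'I_n -> rat) a :
  wdeg (full_weight L) a = wdeg L (mnarrow a) + (a ord_max)%:R.
Proof.
rewrite /wdeg big_ord_recr /= /full_weight append_var_max mulr1; congr (_ + _).
by apply: eq_bigr => i _; rewrite append_var_widen mnmE.
Qed.

Lemma meval_mwiden n (x : 'I_n.+1 -> C) (p : mpoly n C) :
  meval x (mwiden p) = meval (first_vars x) p.
Proof.
rewrite [RHS](meval_sum _ (leqnn _)) (mwidenE (leqnn (msize p))) raddf_sum.
apply: eq_bigr => a _; rewrite /= mevalZ mevalX big_ord_recr /= mnmwiden_ordmax.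
rewrite expr0 mulr1; congr (_ * _); apply: eq_bigr => i _.
by rewrite mnmwiden_widen.
Qed.

Lemma mcoeff_mwiden n (p : mpoly n C) a :
  mcoeff a (mwiden p) = if a ord_max == 0%N then mcoeff (mnarrow a) p else 0.
Proof.
case: eqP => [/mnarrowK {1}<-|a0]; first exact: mwiden_mnmwiden.
rewrite (mwidenE (leqnn (msize p))) raddf_sum big1 // => b _.
rewrite /= mcoeffZ mcoeffX; have [e|] := eqVneq (mnmwiden b) a; last by rewrite mulr0.
by case: a0; rewrite -e mnmwiden_ordmax.
Qed.

Definition restrict0 n : n.+1.-tuple (mpoly n C) :=
  [tuple append_var (fun k => mpolyX C (mnm1 k)) 0 i | i < n.+1].

Lemma cst_free_restrict0 n : cst_free (restrict0 n).
Proof.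
move=> i; rewrite tnth_mktuple /append_var; case: (unlift ord_max i) => [k|].
  by rewrite mcoeffX mnm1_eq0.
by rewrite mcoeff0.
Qed.

Lemma meval_restrict0 n (z : 'I_n -> C) i :
  meval z (tnth (restrict0 n) i) = append_var z 0 i.
Proof.
rewrite tnth_mktuple /append_var; case: (unlift ord_max i) => [k|]; last by rewrite meval0.
by rewrite mevalXU.
Qed.

Lemma mcoeff_restrict0 n (Q : mpoly n.+1 C) b :
  mcoeff b (Q \mPo restrict0 n) = mcoeff (mnmwiden b) Q.
Proof.
rewrite {2}[Q]mpolyE comp_mpolyEX !raddf_sum; apply: eq_bigr => a _ /=.
rewrite !mcoeffZ comp_mpolyX mcoeffX big_ord_recr /= tnth_mktuple append_var_max.
congr (_ * _).
rewrite (eq_bigr (fun i => mpolyX C (mnm1 i) ^+ (mnarrow a i))); last first.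
  by move=> i _; rewrite tnth_mktuple append_var_widen mnmE.
rewrite -mpolyXE_id; have [a0|a0] := eqVneq (a ord_max) 0%N.
  rewrite a0 expr0 mulr1 mcoeffX -{2}(mnarrowK a0) (inj_eq (@inj_mnmwiden n)).
  by [].
rewrite expr0n (negbTE a0) mulr0 mcoeff0.
by case: eqP => // e; move: a0; rewrite e mnmwiden_ordmax eqxx.
Qed.

Lemma holo_taylor_restrict n (g : ('I_n.+1 -> C) -> C) v : holo_taylor g v ->
  holo_taylor (fun z => g (append_var z 0)) (fun b => v (mnmwiden b)).
Proof.
move=> hg; have -> : (fun b => v (mnmwiden b)) = comp_coef (restrict0 n) v.
  apply: funext => b; rewrite /comp_coef mcoeff_restrict0 mcoeff_trunc.
  by rewrite mdeg_widen ltnS leqnn.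
apply: holo_taylor_ext (holo_taylor_comp (@cst_free_restrict0 n) hg) => z.
by congr g; apply: funext => i; rewrite meval_restrict0.
Qed.

Lemma extend_map_taylor n (T : n.-tuple (mpoly n C)) (g : ('I_n.+1 -> C) -> C) v :
  cst_free T -> holo_taylor g v -> exists v', holo_taylor (g \o extend_map T) v'.
Proof.
move=> fT hg; pose E : n.+1.-tuple (mpoly n.+1 C) :=
  [tuple append_var (fun k => mwiden (tnth T k)) (mpolyX C (mnm1 ord_max)) i | i < n.+1].
have fE : cst_free E.
  move=> i; rewrite tnth_mktuple /append_var; case: (unlift ord_max i) => [k|].
    by rewrite -mnmwiden0 mwiden_mnmwiden fT.
  by rewrite mcoeffX mnm1_eq0.
exists (comp_coef E v); apply: holo_taylor_ext (holo_taylor_comp fE hg) => z /=.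
congr g; apply: funext => i; rewrite tnth_mktuple /extend_map /append_var.
by case: (unlift ord_max i) => [k|]; rewrite ?mevalXU ?meval_mwiden.
Qed.

Lemma is_taylor_meval m p (e : ('I_m -> C) -> 'I_p -> C) (q : mpoly p C) :
  (forall i, bigO 1 (fun z => e z i)) ->
  is_taylor e (fun z => meval (e z) q) (fun a => mcoeff a q).
Proof.
move=> he; apply/is_taylorP => // k; exists q; split=> //.
by apply: bigO_ext (bigO_zero R m k) => z; rewrite subrr.
Qed.

Lemma is_taylorD m p (e : ('I_m -> C) -> 'I_p -> C) g g' c c' :
  is_taylor e g c -> is_taylor e g' c' ->
  is_taylor e (fun z => g z + g' z) (fun a => c a + c' a).
Proof.
move=> h h' k.
change (bigO k (fun z => g z + g' z - psum (fun a => c a + c' a) k (e z))).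
apply: bigO_ext (bigO_add (h k) (h' k)) => z.
have -> : psum (fun a => c a + c' a) k (e z) = psum c k (e z) + psum c' k (e z).
  by rewrite -big_split; apply: eq_bigr => a _ /=; rewrite mulrDl.
by rewrite opprD addrACA.
Qed.

End LastVariable.

(** * Existence of a best transformation *)

Section BestTransformation.
Variable R : realType.
Local Notation C := R[i].

(** Induction on |A \ B|: a transposition exchanges a point of A \ B with one of B \ A. Staying
    inside D matters because D will be a set of variables of equal weight. *)
Lemma perm_within (X : finType) (D A B : {set X}) :
  A \subset D -> B \subset D -> #|A| = #|B| ->
  exists s : {perm X}, (forall x, x \notin D -> s x = x) /\
    forall x, x \in B -> (s^-1)%g x \in A.
Proof.
move: {2}#|A :\: B| (leqnn #|A :\: B|) => k.
elim: k A => [|k IH] A hk AD BD cAB.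
  exists 1%g; split=> [x _|x xB]; first by rewrite perm1.
  rewrite invg1 perm1; have : A == B.
    by rewrite eqEcard cAB leqnn andbT -finset.setD_eq0 -cards_eq0 -leqn0.
  by move=> /eqP ->.
have [AB|] := eqVneq (A :\: B)%SET finset.set0; first by apply: IH => //; rewrite AB cards0.
move=> /finset.set0Pn[a]; rewrite inE => /andP[aB aA].
have [b] : exists b, b \in (B :\: A)%SET.
  apply/finset.set0Pn; rewrite -card_gt0 cardsD finset.setIC -cAB -cardsD card_gt0.
  by apply/finset.set0Pn; exists a; rewrite inE aB.
rewrite inE => /andP[bA bB].
have ab : a != b by apply: contraNneq aB => ->.
pose A' := (b |: A :\ a)%SET.
have cA' : #|A'| = #|B|.
  by rewrite -cAB cardsU1 !inE (negbTE bA) andbF (cardsD1 a A) aA.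
have A'D : A' \subset D.
  apply/fintype.subsetP => x; rewrite !inE => /orP[/eqP ->|/andP[_ xA]].
    exact: (fintype.subsetP BD).
  exact: (fintype.subsetP AD).
have hk' : (#|A' :\: B| <= k)%N.
  rewrite -ltnS; apply: leq_trans hk; apply: proper_card; apply/properP; split.
    apply/fintype.subsetP => x; rewrite !inE => /andP[xB /orP[/eqP xb|/andP[_ ->]]]; last by rewrite xB.
    by rewrite xb bB in xB.
  by exists a; rewrite !inE ?aB ?aA // eqxx (negbTE ab) andbF.
have [s [sD sA]] := IH A' hk' A'D BD cA'.
exists (tperm a b * s)%g; split=> [x xD|x xB].
  rewrite permM tpermD ?sD //; apply: contraNneq xD => <-.
    exact: (fintype.subsetP AD).
  exact: (fintype.subsetP BD).
rewrite invMg permM tpermV; have := sA x xB.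
rewrite !inE => /orP[/eqP ->|/andP[xa xA]]; first by rewrite tpermR.
by rewrite tpermD // 1?eq_sym //; apply: contraTneq xA => ->.
Qed.

Definition perm_map n (s : {perm 'I_n}) : n.-tuple (mpoly n C) :=
  [tuple mpolyX C (mnm1 (s i)) | i < n].

Lemma poly_map_perm n (s : {perm 'I_n}) z i : poly_map (perm_map s) z i = z (s i).
Proof. by rewrite /poly_map tnth_mktuple mevalXU. Qed.

Lemma perm_map_homogeneous n (L : 'I_n -> rat) (s : {perm 'I_n}) :
  (forall i, L (s i) = L i) ->
  homogeneous_transformation L (perm_map s^-1) (perm_map s).
Proof.
move=> hs; split.
- move=> i; exists (mpolyX C (mnm1 ((s^-1)%g i)) - mpolyX C (mnm1 i)).
  split; last by rewrite tnth_mktuple addrC subrK.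
  apply: whomogeneousD.
    have <- : L ((s^-1)%g i) = L i by rewrite -hs permKV.
    exact: whomogeneousX.
  by move=> a; rewrite mcoeffN oppr_eq0; apply: whomogeneousX.
- by apply/comp_mapP => z i; rewrite !poly_map_perm permKV.
- by apply/comp_mapP => z i; rewrite !poly_map_perm permK.
Qed.

(** Maximality ranges over arbitrary sets of variables, whereas independence is required of the last
    d. A largest eliminated set lies in the tail of length D, where all weights equal tau, so the
    permutation moving it to the end is homogeneous. *)
Lemma best_exists n N (L : 'I_n -> rat) tau (h : 'I_N -> mpoly n C) D :
  (D <= n)%N -> (forall i : 'I_n, (n - D <= i)%N -> L i = tau) ->
  (forall S U (A : {set 'I_n}), homogeneous_transformation L S U ->
    (forall i, i \in A -> forall j,
      independent_of (fun z => meval (poly_map U z) (h j)) i) ->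
    forall i, i \in A -> (n - D <= i)%N) ->
  exists U d, best_transformation L (sosp h) U d.
Proof.
move=> Dn tail hD.
pose good d := exists S U (A : {set 'I_n}), [/\ homogeneous_transformation L S U,
  forall i, i \in A -> forall j,
      independent_of (fun z => meval (poly_map U z) (h j)) i & #|A| = d].
have ex : exists d, `[< good d >].
  exists 0%N; apply/asboolP; exists (id_map R n), (id_map R n), (finset.set0 : {set 'I_n}).
  split; [exact: homogeneous_transformation_id | by move=> i; rewrite inE | exact: cards0].
have bd d : `[< good d >] -> (d <= n)%N.
  move=> /asboolP[S [U [A [_ _ <-]]]]; rewrite -[leqRHS]card_ord; exact: max_card.
case: (ex_maxnP ex bd) => d /asboolP[S [U [A [hU hA cA]]]] dmax.
have AD i : i \in A -> (n - D <= i)%N := hD S U A hU hA i.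
pose tl k : {set 'I_n} := [set i : 'I_n | (n - k <= i)%N]%SET.
have Atl : A \subset tl D by apply/fintype.subsetP => i /AD; rewrite inE.
have dD : (d <= D)%N by rewrite -cA -(card_tail Dn) subset_leq_card.
have dn := leq_trans dD Dn.
have tltl : tl d \subset tl D.
  by apply/fintype.subsetP => i; rewrite !inE; apply: leq_trans; rewrite leq_sub2l.
have [s [sD sA]] := perm_within Atl tltl (etrans cA (esym (card_tail dn))).
have Ls i : L (s i) = L i.
  have [iD|/sD -> //] := boolP (i \in tl D).
  have siD : s i \in tl D.
    by apply: contraLR iD => siD; rewrite -(perm_inj (sD _ siD)).
  by rewrite !inE in iD siD; rewrite !tail.
have hs := perm_map_homogeneous Ls.
exists (comp_map U (perm_map s)), d; split=> //.
- by exists (comp_map (perm_map s^-1) S); apply: homogeneous_transformation_comp.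
- move=> i ni; apply/independent_transformed => j z z' e.
  have E y : meval (poly_map (comp_map U (perm_map s)) y) (h j) =
      meval (poly_map U (fun k => y (s k))) (h j).
    apply: meval_eq => k; rewrite poly_map_comp; apply: meval_eq => l.
    exact: poly_map_perm.
  rewrite !E; apply: (hA ((s^-1)%g i)); first by apply: sA; rewrite inE.
  by move=> k ki; apply: e; apply: contraNneq ki => <-; rewrite permK.
- move=> S' U' A' hU' hA'; apply: dmax; apply/asboolP; exists S', U', A'.
  by split=> // i /hA' /independent_transformed.
Qed.

End BestTransformation.

(** * The invariant along a run *)

Section Run.
Variable R : realType.
Local Notation C := R[i].
Variables (n N : nat) (f : 'I_N -> ('I_n.+1 -> C) -> C).
Hypothesis f_holo : forall j, holomorphic_near0 (f j).
Hypothesis f_zero : forall j, f j (fun=> 0) = 0.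

Lemma append_var_id (z : 'I_n -> C) :
  append_var (poly_map (id_map R n) z) 0 = append_var z 0.
Proof. by congr append_var; apply: funext => i; rewrite poly_map_id. Qed.

Lemma sos_z_id :
  sos_z f = fun z =>
    \sum_j normc (f j (append_var (poly_map (id_map R n) z) 0)) ^+ 2.
Proof. by apply: funext => z; rewrite append_var_id. Qed.

Lemma initial_taylor : exists u : 'I_N -> multinom n -> C,
  (forall j, holo_taylor (fun z => f j (append_var (poly_map (id_map R n) z) 0)) (u j)) /\
  forall j, u j (@mnm0 n) = 0.
Proof.
have [v hv] := choice (fun j => holomorphic_taylor (f_holo j)).
have hu j : holo_taylor (fun z => f j (append_var (poly_map (id_map R n) z) 0))
    (fun b => v j (mnmwiden b)).
  by apply: holo_taylor_ext (holo_taylor_restrict (hv j)) => z; rewrite append_var_id.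
exists (fun j b => v j (mnmwiden b)); split=> // j.
rewrite (holo_taylor0 (hu j)) -[RHS](f_zero j); congr (f j _).
apply: funext => i; rewrite append_var_id /append_var.
by case: (unlift ord_max i).
Qed.

Lemma cst_free_id : cst_free (id_map R n).
Proof. by move=> i; rewrite tnth_mktuple mcoeffX mnm1_eq0. Qed.

Lemma comp_map_id (U : n.-tuple (mpoly n C)) : comp_map (id_map R n) U = U.
Proof.
apply: eq_from_tnth => i; apply: mpoly_ext => z.
by rewrite -[LHS]/(poly_map _ z i) poly_map_comp poly_map_id.
Qed.

(** F(0) = 0 gives m1 > 0, and the diagonal monomial of index (a, a) in F has degree 2|a| >= m1. *)
Lemma initial_weight (u : 'I_N -> multinom n -> C) m1 :
  (forall j, u j (@mnm0 n) = 0) -> lowest_degree (sosc u) m1 ->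
  0 < (m1%:R)^-1 :> rat /\
  forall j a, u j a != 0 -> 2^-1 <= wdeg (fun=> (m1%:R)^-1) a.
Proof.
move=> u0 [[b [cb bm]] hm].
have m0 : (0 < m1)%N.
  rewrite -bm lt0n mdeg_eq0; apply: contraNneq cb => ->.
  rewrite /sosc big1 // => j _.
  have -> : mleft (@mnm0 (n + n)) = @mnm0 n by apply/mnmP => i; rewrite mleftE !mnm0E.
  by rewrite u0 mul0r.
have m0' : 0 < m1%:R :> rat by rewrite ltr0n.
split=> [|j a ua]; first by rewrite invr_gt0.
have : (m1 <= mdeg (mjoin a a))%N.
  by apply: hm; apply/eqP => /sosc_diag_eq0/(_ j)/eqP; rewrite (negbTE ua).
rewrite mdeg_join wdeg_cst ler_pdivlMr // -(ler_nat rat) natrD.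
by lra.
Qed.

Lemma stage_data_start u m1 P U d :
  (forall j, holo_taylor (fun z => f j (append_var (poly_map (id_map R n) z) 0)) (u j)) ->
  (forall j, u j (@mnm0 n) = 0) -> lowest_degree (sosc u) m1 ->
  is_wpart (double_weight (fun _ : 'I_n => (m1%:R)^-1)) 1 (sosc u) P ->
  best_transformation (fun=> (m1%:R)^-1) P U d ->
  stage_data f U (fun=> (m1%:R)^-1) d (fun j => comp_coef U (u j)).
Proof.
move=> hu u0 hm hP hU; have [t0 ge] := initial_weight u0 hm.
have id_id z i : poly_map (id_map R n) (poly_map (id_map R n) z) i = z i.
  by rewrite !poly_map_id.
have := stage_data_best (S := id_map R n) (L := fun=> (m1%:R)^-1) t0 (fun=> lexx _)
  (fun _ _ => erefl) cst_free_id cst_free_id id_id hu ge hP hU.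
by rewrite comp_map_id.
Qed.

Section Step.
Variables (T : n.-tuple (mpoly n C)) (L : 'I_n -> rat) (d : nat)
  (u : 'I_N -> multinom n -> C) (a : multinom (n + n)).
Hypothesis hT : stage_data f T L d u.
Hypothesis ha : Theta (sosc u) L d a.
Hypothesis hmax : forall b, Theta (sosc u) L d b -> Wratio L d b <= Wratio L d a.

Let L' := next_weight L d (Wratio L d a).

Lemma next_weight_spec : [/\ 0 < Wratio L d a,
  forall i, Wratio L d a < L i,
  forall i : 'I_n, (i < n - d)%N -> L' i = L i,
  forall i : 'I_n, (n - d <= i)%N -> L' i = Wratio L d a
  & forall i, Wratio L d a <= L' i].
Proof.
have [tau [tau0 geL tail]] := stage_weight hT.
have [_ W0 Wt] := Theta_tail tau0 tail ha.
have hd (i : 'I_n) : (i < n - d)%N -> L' i = L i by rewrite /L' /next_weight => ->.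
have tl (i : 'I_n) : (n - d <= i)%N -> L' i = Wratio L d a.
  by rewrite /L' /next_weight ltnNge => ->.
have lt i : Wratio L d a < L i by apply: lt_le_trans (geL i).
split=> // i; case: (ltnP i (n - d)) => [/hd ->|/tl -> //]; exact: ltW.
Qed.

Lemma stage_data_step P U d' :
  is_wpart (double_weight L') 1 (sosc u) P -> best_transformation L' P U d' ->
  (d' <= d)%N /\ stage_data f (comp_map T U) L' d' (fun j => comp_coef U (u j)).
Proof.
move=> hP hU; have [W0 Wlt hd tl geL'] := next_weight_spec.
have ge := next_weight_ge hT ha hmax.
have [S [fS ST]] := stage_inverse hT.
have dd : (d' <= d)%N.
  rewrite leqNgt; apply/negP => lt.
  have [h hh] := wparts_exist 2^-1 u W0 geL'.
  have [dn [S1 hS1] indep _] := hU.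
  (* n - d' is the first index of the new tail; if d' > d it would be an eliminated head
     variable. *)
  have ltn : (n - d' < n)%N by have := stage_dim hT; lia.
  have := independent_in_tail hT hd tl W0 Wlt hh hS1
    (A := [set i : 'I_n | (n - d' <= i)%N]%SET) _ (i := Ordinal ltn).
  rewrite inE /= leqnn => H; suff: (n - d <= n - d')%N by lia.
  apply: H => // i; rewrite inE => /indep.
  by rewrite (wpart_sosp ge hh hP) => /independent_transformed.
split=> //; apply: (stage_data_best W0 geL' _ (stage_cst_free hT) fS ST
  (stage_taylor hT) ge hP hU) => i ni.
by apply: tl; apply: leq_trans ni; rewrite leq_sub2l.
Qed.

Lemma next_best_exists : exists P U d',
  is_wpart (double_weight L') 1 (sosc u) P /\ best_transformation L' P U d'.
Proof.
have [W0 Wlt hd tl geL'] := next_weight_spec.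
have [h hh] := wparts_exist 2^-1 u W0 geL'.
have [P hP] := wpart_exists 1 (sosc u) W0 (double_weight_ge geL').
have ge := next_weight_ge hT ha hmax.
have [U [d' hU]] := best_exists (stage_dim hT) tl
  (fun S U A hU hA => independent_in_tail hT hd tl W0 Wlt hh hU hA).
by exists P, U, d'; rewrite {2}(wpart_sosp ge hh hP).
Qed.

End Step.

Lemma kolar_stage_data T L d : kolar_stage f T L d ->
  exists u, stage_data f T L d u.
Proof.
elim=> {T L d} [c m1 P U d hc hm L1 hP hU|T L d c a P U d' _ [u hT] d0 hc ha hmax L' hP hU].
  have [u [hu u0]] := initial_taylor.
  (* The run may use any family c obeying Taylor's formula; uniqueness identifies it. *)
  have cE : c = sosc u.
    apply: funext; apply: real_taylor_unique hc _.
    rewrite sos_z_id.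
    exact: real_taylor_sos.
  rewrite cE in hm hP; exists (fun j => comp_coef U (u j)).
  exact: stage_data_start hP hU.
have cE : c = sosc u.
  by apply: funext; apply: real_taylor_unique hc (real_taylor_sos (stage_taylor hT)).
rewrite cE in ha hmax hP; exists (fun j => comp_coef U (u j)).
exact: (stage_data_step hT ha hmax hP hU).2.
Qed.

End Run.

(** * Termination *)

Section Termination.
Variable R : realType.
Local Notation C := R[i].
Variables (n N : nat) (f : 'I_N -> ('I_n.+1 -> C) -> C).

Lemma common_denominator (L : 'I_n -> rat) : (forall i, 0 < L i) ->
  exists D : nat, (0 < D)%N /\ forall i, exists m : nat, D%:R * L i = m%:R.
Proof.
move=> L0; exists (\prod_(i < n) `|denq (L i)|%N)%N; split.
  by apply: prodn_gt0 => i; rewrite absz_gt0 denq_neq0.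
move=> i; rewrite (bigD1 i) //=; set q := (\prod_(_ < n | _) _)%N.
exists (q * `|numq (L i)|)%N; rewrite !natrM mulrAC mulrC; congr (_ * _).
have numE : (`|numq (L i)|%N%:R : rat) = (numq (L i))%:~R.
  by rewrite -[LHS]/((`|numq (L i)|%N : int)%:~R) gez0_abs // numq_ge0 ltW.
have denE : (`|denq (L i)|%N%:R : rat) = (denq (L i))%:~R.
  by rewrite -[LHS]/((`|denq (L i)|%N : int)%:~R) gez0_abs // denq_ge0.
by rewrite numE denE numqE mulrC.
Qed.

Section Integrality.
Variables (c : multinom (n + n) -> C) (L : 'I_n -> rat) (d D B : nat) (tau : rat).
Hypothesis L_ge0 : forall i, 0 <= L i.
Hypothesis D_head : forall i : 'I_n, (i < n - d)%N ->
  exists m : nat, D%:R * L i = m%:R.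
Hypothesis D_gt0 : (0 < D)%N.
Hypothesis B_gt0 : (0 < B)%N.
Hypothesis tau_gt0 : 0 < tau.
Hypothesis tail : forall i : 'I_n, (n - d <= i)%N -> L i = tau.

Lemma head_weight_ge0 a : 0 <= head_weight L d a.
Proof. by apply: sumr_ge0 => i _; rewrite mulr_ge0. Qed.

Lemma head_weight_integral a : exists m : nat, D%:R * head_weight L d a = m%:R.
Proof.
rewrite /head_weight mulr_sumr; elim/big_ind: _ => [|x y [m ->] [m' ->]|i hi].
- by exists 0%N.
- by exists (m + m')%N; rewrite natrD.
- have [m hm] := D_head hi; exists (var_degree a i * m)%N.
  by rewrite mulrCA hm natrM.
Qed.

(** The numerator of W is at most 1 and a multiple of 1/D; W >= 1/(2B) then forces the tail degree
    to be at most 2B, so it divides (2B)!. *)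
Lemma Wratio_integral b : Theta c L d b ->
  (2 * B)%N%:R^-1 <= Wratio L d b ->
  exists v : nat, Wratio L d b * (D * (2 * B)`!)%N%:R = v%:R.
Proof.
move=> hb hB; have [t0 _ _] := Theta_tail tau_gt0 tail hb; case: hb => _ _ h1.
have t0' : 0 < (tail_degree d b)%:R :> rat by rewrite ltr0n.
have ge0 := head_weight_ge0 b; have [m hm] := head_weight_integral b.
have mD : (m <= D)%N by rewrite -(ler_nat rat) -hm ger_pMr ?ltr0n // ltW.
have tB : (tail_degree d b <= 2 * B)%N.
  rewrite -(ler_nat rat) -lef_pV2 ?posrE ?ltr0n ?muln_gt0 //.
  apply: le_trans hB _; rewrite /Wratio -/(tail_degree d b).
  by rewrite ler_pdivrMr // mulVf ?lt0r_neq0 // lerBlDr lerDl.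
have /dvdnP[q hq] : (tail_degree d b %| (2 * B)`!)%N by apply: dvdn_fact; rewrite t0.
exists ((D - m) * q)%N; rewrite hq /Wratio -/(tail_degree d b) !natrM natrB // -hm.
by field; rewrite lt0r_neq0.
Qed.

(* [D * (2 B)!] is a common denominator of the values of W above 1/(2B). *)
Lemma Wratio_max b0 : Theta c L d b0 -> (2 * B)%N%:R^-1 <= Wratio L d b0 ->
  exists a v, [/\ Theta c L d a,
    forall b, Theta c L d b -> Wratio L d b <= Wratio L d a
    & Wratio L d a * (D * (2 * B)`!)%N%:R = v%:R].
Proof.
move=> hb0 hB0; set M := (D * (2 * B)`!)%N.
have M0 : 0 < M%:R :> rat by rewrite ltr0n muln_gt0 D_gt0 fact_gt0.
pose good v := exists b, [/\ Theta c L d b, (2 * B)%N%:R^-1 <= Wratio L d b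
  & Wratio L d b * M%:R = v%:R].
have ex : exists v, `[< good v >].
  have [v hv] := Wratio_integral hb0 hB0.
  by exists v; apply/asboolP; exists b0.
(* Theta may be infinite, but ratios of at least 1/(2B) are multiples of 1/M below tau, so they take
   finitely many values; smaller ratios cannot win. *)
have bd v : `[< good v >] -> (v <= Num.bound (tau * M%:R))%N.
  move=> /asboolP[b [hb _ e]]; have [_ _ Wt] := Theta_tail tau_gt0 tail hb.
  rewrite -(ler_nat rat) -e ltW //; apply: lt_trans (archi_boundP _).
    by rewrite ltr_pM2r.
  by rewrite mulr_ge0 // ltW.
case: (ex_maxnP ex bd) => v /asboolP[a [ha haB hv]] vmax.
exists a, v; split=> // b hb.
have [hbB|/ltW hbB] := lerP (2 * B)%N%:R^-1 (Wratio L d b); last exact: le_trans haB.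
have [w hw] := Wratio_integral hb hbB.
rewrite -(ler_pM2r M0) hv hw ler_nat; apply: vmax.
by apply/asboolP; exists b.
Qed.

End Integrality.

Hypothesis n_gt0 : (0 < n)%N.
Hypothesis f_holo : forall j, holomorphic_near0 (f j).
Hypothesis f_zero : forall j, f j (fun=> 0) = 0.
Hypothesis finite_type : (dangelo_type (sos f) < +oo)%E.

(** This variable belongs to the tail at every stage with d > 0. *)
Let last : 'I_n := Ordinal (etrans (ltn_predL n) n_gt0).

Let mdeg_last k : mdeg (mnm_muln (mnm1 last) k) = k.
Proof. by rewrite mdegMn mdeg1 mul1n. Qed.

Let wdeg_last (L : 'I_n -> rat) k :
  wdeg L (mnm_muln (mnm1 last) k) = k%:R * L last.
Proof.
elim: k => [|k IH]; first by rewrite mulm0n wdeg0 mul0r.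
by rewrite mulmS wdegD wdeg1 IH -natr1 mulrDl mul1r addrC.
Qed.

(** The pure power of exponent k contributes its squared modulus to F, of head weight 0 and tail
    degree at most 2k. Its weight exceeds 1 strictly because parts of weight 1/2 contain no tail
    variable. *)
Lemma Theta_last T L d u k j :
  stage_data f T L d u -> (0 < d)%N -> u j (mnm_muln (mnm1 last) k) != 0 ->
  let b := mjoin (mnm_muln (mnm1 last) k) (mnm_muln (mnm1 last) k) in
  Theta (sosc u) L d b /\ (2 * k)%N%:R^-1 <= Wratio L d b.
Proof.
move=> hT d0; set al := mnm_muln _ _ => ual b.
have [tau [tau0 geL tail]] := stage_weight hT.
have last_tail : (n - d <= last)%N by rewrite /=; lia.
have k0 : k != 0%N.
  apply: contraTneq (stage_ge hT ual) => k0.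
  by rewrite wdeg_last k0 mul0r -ltNge.
have alE i : al i = ((i == last) * k)%N by rewrite mulmnE mnm1E eq_sym.
have h0 : head_weight L d b = 0.
  rewrite /head_weight big1 // => i hi.
  have il : i != last by apply: contraTneq hi => ->; rewrite -leqNgt.
  by rewrite /var_degree mjoin_lshift mjoin_rshift alE (negbTE il) mul0n mul0r.
have w1 : 1 < wdeg (double_weight L) b.
  rewrite wdeg_join; have := stage_ge hT ual; rewrite le_eqVlt => /orP[/eqP e|].
    have := stage_tail hT ual (esym e) last_tail.
    by rewrite alE eqxx mul1n => e'; rewrite e' in k0.
  by lra.
have hb : Theta (sosc u) L d b.
  split; rewrite ?h0 //.
  by apply/eqP => /sosc_diag_eq0/(_ j)/eqP; rewrite (negbTE ual).
split=> //; have [t0 _ _] := Theta_tail tau0 tail hb.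
rewrite /Wratio -/(tail_degree d b) h0 subr0 div1r.
rewrite lef_pV2 ?posrE ?ltr0n ?muln_gt0 //= ?(lt0n k) // ler_nat.
have -> : (2 * k = mdeg b)%N by rewrite mdeg_join mdeg_last mul2n addnn.
rewrite /b mdeg_join !mdegE -big_split /= /tail_degree.
rewrite [leqRHS](bigID (fun i : 'I_n => (n - d <= i)%N)) /=.
apply: leq_trans (leq_addr _ _); apply: leq_sum => i _.
by rewrite /var_degree mjoin_lshift mjoin_rshift.
Qed.

(* d never increases; while it is constant, so are the head weights, and the tail
   weight decreases strictly through multiples of [1/M]. *)
Lemma kolar_run B :
  (forall T L d u, stage_data f T L d u ->
     exists j k, (k <= B)%N /\ u j (mnm_muln (mnm1 last) k) != 0) ->
  forall d T L u, kolar_stage f T L d -> stage_data f T L d u ->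
  exists T' L', kolar_output f T' L'.
Proof.
move=> hB; elim/ltn_ind => d IHd; case: (posnP d) => [->|d0] T0 L0 u0 hK0 hT0.
  by exists T0, L0.
have [tau0 [t00 geL0 _]] := stage_weight hT0.
have [D [D0 hD0]] := common_denominator (fun i => lt_le_trans t00 (geL0 i)).
(* Only the denominators of head weights are kept: they survive a step with unchanged d, while the
   tail weight changes. *)
have {hD0} : forall i : 'I_n, (i < n - d)%N -> exists m : nat, D%:R * L0 i = m%:R.
  by move=> i _.
(* B + 1 replaces B, which may be 0, since [Wratio_max] requires a positive bound. *)
set M := (D * (2 * B.+1)`!)%N.
have M0 : 0 < M%:R :> rat by rewrite ltr0n muln_gt0 D0 fact_gt0.
(* m bounds M times the tail weight and serves as the counter of the inner induction; m = 0
   contradicts positivity of the weight. *)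
have [m] : exists m : nat, L0 last * M%:R <= m%:R.
  exists (Num.bound (L0 last * M%:R)); apply/ltW/archi_boundP.
  by rewrite mulr_ge0 ?ltW // (lt_le_trans t00).
have last_tail : (n - d <= last)%N by rewrite /=; lia.
elim: m T0 L0 u0 hK0 hT0 {tau0 t00 geL0} => [|m IHm] T L u hK hT hm hD.
  have [tau [t0 geL tail]] := stage_weight hT.
  by move: hm; rewrite pmulr_lle0 // leNgt (lt_le_trans t0).
have [tau [t0 geL tail]] := stage_weight hT.
have [j [k [kB ujk]]] := hB _ _ _ _ hT.
have [hb0 Wb0] := Theta_last hT d0 ujk.
have k0 : (0 < k)%N.
  rewrite lt0n; apply: contraTneq (stage_ge hT ujk) => k0.
  by rewrite wdeg_last k0 mul0r -ltNge.
have WB : (2 * B.+1)%N%:R^-1 <= Wratio L d (mjoin (mnm_muln (mnm1 last) k) (mnm_muln (mnm1 last) k)).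
  apply: le_trans Wb0; rewrite lef_pV2 ?posrE ?ltr0n ?muln_gt0 // ler_nat.
  by rewrite leq_mul2l /= (leq_trans kB).
have L_ge0 i : 0 <= L i by apply: ltW (lt_le_trans t0 (geL i)).
have [a [v [ha hmax hv]]] := Wratio_max L_ge0 hD D0 (ltn0Sn B) t0 tail hb0 WB.
have [P [U [d' [hP hU]]]] := next_best_exists hT ha hmax.
have [dd hT'] := stage_data_step hT ha hmax hP hU.
have hK' : kolar_stage f (comp_map T U) (next_weight L d (Wratio L d a)) d'.
  exact: (KolarStep hK d0 (real_taylor_sos (stage_taylor hT)) ha hmax hP hU).
move: dd; rewrite leq_eqVlt => /orP[/eqP dd|dd]; last exact: IHd dd _ _ _ hK' hT'.
rewrite dd in hK' hT'; apply: IHm hK' hT' _ _; last first.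
  by move=> i hi; rewrite /next_weight hi; apply: hD.
have -> : next_weight L d (Wratio L d a) last = Wratio L d a.
  by rewrite /next_weight ltnNge last_tail.
(* The integer v = M W is strictly below M times the old tail weight, hence below m + 1. *)
rewrite hv ler_nat -ltnS -(ltr_nat rat) -hv; apply: lt_le_trans hm.
have [_ _ Wt] := Theta_tail t0 tail ha.
by rewrite ltr_pM2r // tail.
Qed.

Lemma kolar_output_exists : exists T L, kolar_output f T L.
Proof.
have [B hB] := finite_type_bound finite_type.
have hB' T L d u : stage_data f T L d u ->
    exists j k, (k <= B)%N /\ u j (mnm_muln (mnm1 last) k) != 0.
  move=> hT; have [S [fS ST]] := stage_inverse hT.
  exact: hB (stage_cst_free hT) fS ST (stage_taylor hT).
have [u [hu u0]] := initial_taylor f_holo f_zero.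
have id_id z i : poly_map (id_map R n) (poly_map (id_map R n) z) i = z i.
  by rewrite !poly_map_id.
(* In the identity coordinates the bound shows that F has a nonzero Taylor coefficient, so a lowest
   degree exists. *)
have [j [k [_ ujk]]] := hB _ _ u last (@cst_free_id R n) (@cst_free_id R n) id_id hu.
have [m1 hm1] : exists m1, lowest_degree (sosc u) m1.
  have ex : exists m, `[< exists a, sosc u a != 0 /\ mdeg a = m >].
    pose al := mnm_muln (mnm1 last) k; exists (mdeg (mjoin al al)).
    apply/asboolP; exists (mjoin al al); split=> //.
    by apply/eqP => /sosc_diag_eq0/(_ j)/eqP; rewrite (negbTE ujk).
  case: (ex_minnP ex) => m /asboolP hm hmin; exists m; split=> // a ha.
  by apply: hmin; apply/asboolP; exists a.
have [w0 ge] := initial_weight u0 hm1.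
pose L1 : 'I_n -> rat := fun=> (m1%:R)^-1.
have [h hh] := @wparts_exist _ _ _ L1 _ 2^-1 u w0 (fun=> lexx _).
have [P hP] := wpart_exists 1 (sosc u) w0 (double_weight_ge (L := L1) (fun=> lexx _)).
have [U [d hU]] : exists U d, best_transformation L1 (sosp h) U d.
  (* At the first stage all weights agree, so the whole set of variables is the tail: D = n. *)
  by apply: (@best_exists _ _ _ _ (m1%:R)^-1 _ n) => // *; rewrite subnn.
have PE : P = sosp h by apply: wpart_sosp hP.
rewrite -PE in hU.
have hc : real_taylor (sos_z f) (sosc u) by rewrite sos_z_id; apply: real_taylor_sos.
have hK := KolarStart hc hm1 hP hU.
exact: (kolar_run hB' hK (stage_data_start hu u0 hm1 hP hU)).
Qed.

End Termination.

(** * The model *)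

Section Model.
Variable R : realType.
Local Notation C := R[i].

(** The stages follow the f_j only on z_(n+1) = 0. This suffices, since a monomial containing
    z_(n+1) has weight at least 1, hence does not enter the part of weight 1/2. *)
Lemma model_sos n N (f : 'I_N -> ('I_n.+1 -> C) -> C) T L u :
  (forall j, holomorphic_near0 (f j)) -> stage_data f T L 0 u ->
  exists (h : 'I_N -> mpoly n C) (H : mpoly (n.+1 + n.+1) C),
    [/\ forall j, is_holo_part (f j \o extend_map T) L 2^-1 (h j),
        is_model (sos f \o extend_map T) L H
      & forall z : 'I_n.+1 -> C,
          meval (zzbar z) H =
          (2 * complex.Re (z ord_max)
           + \sum_(j < N) normc (meval (first_vars z) (h j)) ^+ 2)%:C].
Proof.
move=> f_holo hT; have [tau [tau0 geL _]] := stage_weight hT.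
have L0 i : 0 <= L i by apply: ltW (lt_le_trans tau0 (geL i)).
have [v hv] : exists v : 'I_N -> multinom n.+1 -> C,
    forall j, holo_taylor (f j \o extend_map T) (v j).
  have [v hv] := choice (fun j => holomorphic_taylor (f_holo j)).
  have [v' hv'] := choice (fun j => extend_map_taylor (stage_cst_free hT) (hv j)).
  by exists v'.
have uv j b : v j (mnmwiden b) = u j b.
  apply: (holo_taylor_unique (holo_taylor_restrict (hv j))).
  apply: holo_taylor_ext (stage_taylor hT j) => z /=; congr (f j _).
  apply: funext => i; rewrite /extend_map append_var_max; congr (append_var _ _ i).
  by congr poly_map; apply: funext => k; rewrite /first_vars append_var_widen.
have wge a : (a : multinom n.+1) ord_max != 0%N -> 1 <= wdeg (full_weight L) a.
  move=> a0; rewrite wdeg_full; apply: ler_wpDl; last by rewrite ler1n lt0n.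
  by apply: sumr_ge0 => i _; rewrite mulr_ge0.
have geV j a : v j a != 0 -> 2^-1 <= wdeg (full_weight L) a.
  have [a0|/wge h _] := eqVneq (a ord_max) 0%N; last by lra.
  rewrite -{1}(mnarrowK a0) uv => /(stage_ge hT).
  by rewrite wdeg_full a0 addr0.
have [h hh] := wparts_exist 2^-1 u tau0 geL.
have hw j : is_wpart (full_weight L) 2^-1 (v j) (mwiden (h j)).
  move=> a; rewrite mcoeff_mwiden; have [a0|/wge a1] := eqVneq (a ord_max) 0%N.
    by rewrite hh wdeg_full a0 addr0 -uv (mnarrowK a0).
  by rewrite ifN //; apply/eqP => e; lra.
have [tau1 tau1_gt0 geF] : exists2 t : rat, 0 < t & forall i, t <= full_weight L i.
  (* The weight 1 of z_(n+1) need not exceed tau. *)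
  exists (Num.min tau 1) => [|i]; first by rewrite lt_min tau0 ltr01.
  rewrite /full_weight /append_var; case: (unlift ord_max i) => [k|].
    by rewrite ge_min geL.
  by rewrite ge_min lexx orbT.
have [P hP] := wpart_exists 1 (sosc v) tau1_gt0 (double_weight_ge geF).
have PE := wpart_sosp geV hw hP.
pose Q : mpoly (n.+1 + n.+1) C :=
  mpolyX C (mnm1 (lshift _ ord_max)) + mpolyX C (mnm1 (rshift _ ord_max)).
have QE z : meval (zzbar z) Q = (2 * complex.Re (z ord_max))%:C.
  rewrite mevalD !mevalXU zzbar_lshift zzbar_rshift rmorphM rmorph_nat.
  exact: addcJ.
exists h, (Q + P); split.
- by move=> j; exists (v j).
- exists (fun a => mcoeff a Q + sosc v a); split.
    have := is_taylorD (is_taylor_meval Q (@bigO_zzbar R n.+1)) (real_taylor_sos hv).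
    have -> // : (fun z => meval (zzbar z) Q +
        (\sum_j normc ((f j \o extend_map T) z) ^+ 2)%:C) =
      (fun z => ((sos f \o extend_map T) z)%:C).
    apply: funext => z; rewrite QE -rmorphD /= /sos /extend_map append_var_max.
    by [].
  move=> a; rewrite mcoeffD hP.
  have Q0 : wdeg (double_weight (full_weight L)) a != 1 -> mcoeff a Q = 0.
    move=> wa; rewrite mcoeffD !mcoeffX; have [e|_] := eqVneq (mnm1 (lshift n.+1 ord_max)) a.
      by move: wa; rewrite -e wdeg1 /double_weight (unsplitK (inl _ _)) /full_weight append_var_max eqxx.
    have [e|_] := eqVneq (mnm1 (rshift n.+1 ord_max)) a; last by rewrite addr0.
    by move: wa; rewrite -e wdeg1 /double_weight (unsplitK (inr _ _)) /full_weight append_var_max eqxx.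
  by case: ifPn => // /Q0 ->; rewrite addr0.
- move=> z; rewrite mevalD QE PE meval_sosp -rmorphD; congr ((_ + _)%:C).
  by apply: eq_bigr => j _; rewrite meval_mwiden.
Qed.

End Model.

Unset Implicit Arguments.

Theorem theorem1p1 (R : realType) (n N : nat)
    (f : 'I_N -> ('I_n.+1 -> R[i]) -> R[i])
    (n_gt0 : (0 < n)%N)
    (f_holo : forall j, holomorphic_near0 (f j))
    (f_zero : forall j, f j (fun=> 0) = 0)
    (finite_type : (dangelo_type (sos f) < +oo)%E) :
  (exists T L, kolar_output f T L) /\
  forall (T : n.-tuple (mpoly.mpoly n R[i])) (L : 'I_n -> rat),
    multitype_weight [set z | sos f z = 0] L ->
    kolar_output f T L ->
    exists (h : 'I_N -> mpoly.mpoly n R[i])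
           (H : mpoly.mpoly (n.+1 + n.+1) R[i]),
      [/\ forall j, is_holo_part (f j \o extend_map T) L 2^-1 (h j),
          is_model (sos f \o extend_map T) L H
        & forall z : 'I_n.+1 -> R[i],
            mpoly.meval (zzbar z) H =
            (2 * complex.Re (z ord_max)
             + \sum_(j < N) normc (mpoly.meval (first_vars z) (h j)) ^+ 2)%:C].
Proof.
split; first exact: kolar_output_exists.
by move=> T L _ /(kolar_stage_data f_holo f_zero)[u hT]; apply: model_sos hT.
Qed.
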